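(* Let $\mathbf G$ be a simple simply-connected classical group of type $B_n$, $C_n$ or $D_n$ defined over the finite field $\mathbb F_q$ with corresponding Steinberg morphism $F$. Let $(\lambda,\mu)=((\lambda_1,\dots,\lambda_r),(\mu_1,\dots,\mu_s))$ be a pair of partitions of $n$, and $\mathbf T$ a corresponding $F$-stable maximal torus of $\mathbf G$. Then $\mathbf T^F$ contains regular elements if one of the following conditions is fulfilled: (1) $q>3$, $\lambda_1<\lambda_2<\dots<\lambda_r$ and $\mu_1<\mu_2<\dots<\mu_s$; (2) $q\in\{2,3\}$, $\lambda_1<\lambda_2<\dots<\lambda_r$, $\mu_1<\mu_2<\dots<\mu_s$, all $\lambda_i\neq2$, and if $\mathbf G$ is of type $B_n$ or $C_n$ then also all $\lambda_i\ne1$; or (3) $\mathbf G$ is of type $D_n$, $2<\lambda_1<\lambda_2<\dots<\lambda_r$ and $1=\mu_1=\mu_2<\mu_3<\dots<\mu_s$.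
   Context: The fixed point groups $\mathbf G^F$ considered are $\mathrm{Spin}_{2n+1}(q)$, $\mathrm{Sp}_{2n}(q)$, $\mathrm{Spin}^\pm_{2n}(q)$ ($q$ any prime power). An element $t\in\mathbf T^F$ is regular if its connected centraliser $C^\circ_{\mathbf G}(t)$ equals $\mathbf T$. A pair of partitions of $n$ means $|\lambda|+|\mu|=n$; parts are positive integers, written in increasing order, and $\lambda$ or $\mu$ may be empty. Parameterisation of maximal tori. Consider $\mathrm{Sp}_{2n}(K)$, $\mathrm{SO}_{2n+1}(K)$, and $\mathrm{SO}_{2n}(K)\subset\mathrm{SO}_{2n+1}(K)$ ($K=\overline{\mathbb F_q}$) with the diagonal maximal torus, with entries $t_1^{\pm1},\dots,t_n^{\pm1}$ (and $1$), on which the Weyl group acts through permutations of the entries; it is $C_2\wr\mathfrak S_n$ for types $B_n,C_n$ and a subgroup of index 2 for type $D_n$. $F$-stable maximal tori are obtained by twisting the diagonal torus with $w\in C_2\wr\mathfrak S_n$; the torus corresponds to $(\lambda,\mu)$ if the cycles of $w$ containing both $t_i$ and $t_i^{-1}$ for some $i$ have lengths $2\mu_1,\dots,2\mu_s$ and the remaining cycles come in pairs of equal lengths $\lambda_1,\dots,\lambda_r$ (permuting entries and their inverses in the same way). Then $|\mathbf T^F|=\prod_i(q^{\lambda_i}-1)\prod_j(q^{\mu_j}+1)$. In type $D_n$, $\mu$ has an even number of parts if $F$ is untwisted and an odd number of parts if $F$ is twisted (if $\mu$ is empty and all parts of $\lambda$ are even, two classes of tori correspond to $(\lambda,\mu)$).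 Tori in the simply connected groups are parameterised via the isogeny $\mathrm{Spin}_m(K)\to\mathrm{SO}_m(K)$. *)

(* Defs.v *)
From HB Require Import structures.
From mathcomp Require Import all_boot all_order all_fingroup all_algebra.
From mathcomp Require Import mpoly.

Set Implicit Arguments.
Unset Strict Implicit.
Unset Printing Implicit Defensive.

Import GRing.Theory.
Local Open Scope ring_scope.

(* Algebraic groups over an algebraically closed field K are taken as groups
   of K-points, i.e. as subsets of 'M[K]_N contained in GL_N(K).  The Zariski
   topology of GL_N(K) is the one induced from the affine space 'M[K]_N. *)

Section Zariski.
Variables (K : fieldType) (N : nat).
Implicit Types (S Z C : 'M[K]_N -> Prop).

Definition zariski_closed Z : Prop :=
  exists E : {mpoly K[N * N]} -> Prop,
    forall x, Z x <-> (forall p, E p -> p.@[fun i => mxvec x 0 i] = 0).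

Definition zariski_connected C : Prop :=
  forall Z1 Z2, zariski_closed Z1 -> zariski_closed Z2 ->
    (forall x, C x -> Z1 x \/ Z2 x) ->
    ~ (exists x, [/\ C x, Z1 x & Z2 x]) ->
    (forall x, C x -> Z1 x) \/ (forall x, C x -> Z2 x).

Definition identity_component S x : Prop :=
  exists C, [/\ zariski_connected C, (forall y, C y -> S y), C 1%:M & C x].

Definition centraliser S (t x : 'M[K]_N) : Prop := S x /\ x *m t = t *m x.

End Zariski.

(* The spin module of the hyperbolic quadratic space of dimension 2k is the
   exterior algebra of K^k, with basis e_S for S : {set 'I_k}; matrices act on
   columns.  [create i] is left exterior multiplication by e_i and
   [annihilate i] is contraction by the i-th dual vector; they generate the
   Clifford algebra, identified in this way with the full matrix algebra. *)

Section Clifford.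
Variables (K : fieldType) (k : nat).

Definition spin_dim : nat := #|{: {set 'I_k}}|.

Definition wedge_sign (i : 'I_k) (S : {set 'I_k}) : K :=
  (-1) ^+ #|[set j in S | (j < i)%N]|.

Definition create (i : 'I_k) : 'M[K]_spin_dim :=
  \matrix_(r, c)
    let R := enum_val r : {set 'I_k} in let C := enum_val c : {set 'I_k} in
    if (i \notin C) && (R == i |: C) then wedge_sign i C else 0.

Definition annihilate (i : 'I_k) : 'M[K]_spin_dim := (create i)^T.

End Clifford.

(* The orthogonal space of dimension n + n + b (b = 0 or 1), with coordinates
   x_1, ..., x_n, y_1, ..., y_n and (if b = 1) z, and quadratic form
   x_1 y_1 + ... + x_n y_n (+ z^2).  It is non-degenerate (non-defective for
   b = 1) in every characteristic. *)

Section Orthogonal.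
Variables (K : fieldType) (n b : nat).

Definition qform (v : 'cV[K]_(n + n + b)) : K :=
  \sum_(i < n) v (lshift b (lshift n i)) 0 * v (lshift b (rshift n i)) 0
  + \sum_(j < b) v (rshift (n + n) j) 0 ^+ 2.

(* For b = 1 the space is embedded in the hyperbolic space of dimension
   2(n + 1) by letting z be the coordinate of e + f for the last hyperbolic
   pair (e, f); the Clifford algebra embeds accordingly. *)
Definition clifford (v : 'cV[K]_(n + n + b)) : 'M[K]_(spin_dim (n + b)) :=
  \sum_(i < n) (v (lshift b (lshift n i)) 0 *: create K (lshift b i)
                + v (lshift b (rshift n i)) 0 *: annihilate K (lshift b i))
  + \sum_(j < b) v (rshift (n + n) j) 0 *:
      (create K (rshift n j) + annihilate K (rshift n j)).

(* Products of an even number of vectors of norm 1 in the Clifford algebra: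
   over an algebraically closed field, of any characteristic, these are the
   elements of spinor norm 1 in the even Clifford group. *)
Definition spin (x : 'M[K]_(spin_dim (n + b))) : Prop :=
  exists s : seq 'cV[K]_(n + n + b),
    [/\ ~~ odd (size s), all (fun v => qform v == 1) s
      & x = \big[mulmx/1%:M]_(v <- s) clifford v].

(* x |-> A is the isogeny from Spin to SO. *)
Definition spin_covers (x : 'M[K]_(spin_dim (n + b)))
    (A : 'M[K]_(n + n + b)) : Prop :=
  forall v, x *m clifford v = clifford (A *m v) *m x.

(* The vector e_n + f_n of norm 1.  Conjugation by its image in the Clifford
   algebra exchanges e_n and f_n and maps the other e_i, f_i to -e_i, -f_i. *)
Definition swap_vector : 'cV[K]_(n + n + b) :=
  \col_i ((i == n.-1 :> nat) || (i == (n + n).-1 :> nat))%:R.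

End Orthogonal.

Section Entries.
Variables (K : fieldType) (n : nat).
Implicit Types (a : 'I_n -> K).

(* diag(t_1, ..., t_n, t_1^-1, ..., t_n^-1), followed by b entries 1. *)
Definition diag_entries (b : nat) a : 'M[K]_(n + n + b) :=
  diag_mx (row_mx (row_mx (\row_i a i) (\row_i (a i)^-1)) (const_mx 1)).

(* The index (i, false) stands for the entry t_i and (i, true) for t_i^-1. *)
Definition entry a (p : 'I_n * bool) : K := if p.2 then (a p.1)^-1 else a p.1.

Definition symplectic (x : 'M[K]_(n + n)) : Prop :=
  let J := block_mx 0 1%:M (- 1%:M) 0 in x^T *m J *m x = J.

End Entries.

(* [TypeD false] is the untwisted and [TypeD true] the twisted type D. *)
Inductive classical_type := TypeB | TypeC | TypeD of bool.

(* The ranks for which the groups are simple. *)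
Definition simple_rank (X : classical_type) (n : nat) : bool :=
  match X with TypeB | TypeC => 0 < n | TypeD _ => 2 < n end%N.

Definition ambient_dim (X : classical_type) (n : nat) : nat :=
  match X with
  | TypeB => spin_dim (n + 1)
  | TypeC => n + n
  | TypeD _ => spin_dim (n + 0)
  end.

Section ClassicalGroups.
Variables (K : fieldType) (q : nat) (X : classical_type) (n : nat).

Definition classical_group : 'M[K]_(ambient_dim X n) -> Prop :=
  match X as Y return 'M[K]_(ambient_dim Y n) -> Prop with
  | TypeB => @spin K n 1
  | TypeC => @symplectic K n
  | TypeD _ => @spin K n 0
  end.

(* x lies over the diagonal matrix with entries t_i = a i and t_i^-1. *)
Definition diagonal_over : 'M[K]_(ambient_dim X n) -> ('I_n -> K) -> Prop :=
  match X as Y return 'M[K]_(ambient_dim Y n) -> ('I_n -> K) -> Prop with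
  | TypeB => fun x a => spin_covers x (diag_entries 1 a)
  | TypeC => fun x a => x = diag_mx (row_mx (\row_i a i) (\row_i (a i)^-1))
  | TypeD _ => fun x a => spin_covers x (diag_entries 0 a)
  end.

(* The quadratic and symplectic forms are defined over the prime field, so
   raising matrix entries to the q-th power is the split Frobenius map; in the
   twisted case it is composed with the graph automorphism induced by the
   swap of e_n and f_n. *)
Definition frobenius : 'M[K]_(ambient_dim X n) -> 'M[K]_(ambient_dim X n) :=
  match X as Y return 'M[K]_(ambient_dim Y n) -> 'M[K]_(ambient_dim Y n) with
  | TypeB | TypeC | TypeD false => map_mx (fun c => c ^+ q)
  | TypeD true => fun x =>
      let u := clifford (swap_vector K n 0) in
      u *m map_mx (fun c => c ^+ q) x *m invmx u
  end.

Definition diagonal_torus (x : 'M[K]_(ambient_dim X n)) (a : 'I_n -> K) : Prop :=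
  [/\ classical_group x, forall i, a i != 0 & diagonal_over x a].

(* F acts on g T0 g^-1 as w composed with the q-th power map acts on the
   entries of the diagonal torus T0. *)
Definition twisted_by (g : 'M[K]_(ambient_dim X n)) (w : {perm 'I_n * bool}) : Prop :=
  forall x a, diagonal_torus x a ->
    exists2 a', diagonal_torus
                  (invmx g *m frobenius (g *m x *m invmx g) *m g) a'
              & forall p, entry a' (w p) = entry a p ^+ q.

Definition regular_in (T : 'M[K]_(ambient_dim X n) -> Prop)
    (t : 'M[K]_(ambient_dim X n)) : Prop :=
  forall x, identity_component (centraliser classical_group t) x <-> T x.

End ClassicalGroups.

(* Permutations of the 2n entries compatible with inversion, i.e. elements of
   the wreath product of C_2 and S_n. *)
Definition entry_inv n (p : 'I_n * bool) : 'I_n * bool := (p.1, ~~ p.2).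

Definition signed_perm n (w : {perm 'I_n * bool}) : Prop :=
  forall p, w (entry_inv p) = entry_inv (w p).

Definition self_inverse_cycle n (P : {set 'I_n * bool}) : bool :=
  [exists p in P, entry_inv p \in P].

Definition has_cycle_type n (w : {perm 'I_n * bool}) (lam mu : seq nat) : Prop :=
  perm_eq [seq #|(P : {set _})| | P <- enum (porbits w) & self_inverse_cycle P]
          [seq (2 * m)%N | m <- mu]
  /\ perm_eq
       [seq #|(P : {set _})| | P <- enum (porbits w) & ~~ self_inverse_cycle P]
       (lam ++ lam).

(* T is an F-stable maximal torus corresponding to (lam, mu). *)
Definition corresponds (K : fieldType) (q : nat) (X : classical_type) (n : nat)
    (T : 'M[K]_(ambient_dim X n) -> Prop) (lam mu : seq nat) : Prop :=
  exists g w,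
    [/\ classical_group g,
        forall x, T x <-> exists a, diagonal_torus (invmx g *m x *m g) a,
        signed_perm w, twisted_by q g w & has_cycle_type w lam mu].

Definition partition_pair (n : nat) (lam mu : seq nat) : Prop :=
  [/\ sorted leq lam, sorted leq mu, 0%N \notin lam, 0%N \notin mu
    & (sumn lam + sumn mu)%N = n].

(* Main.v *)
Require Import Defs.
From HB Require Import structures.
From mathcomp Require Import all_boot all_order all_fingroup all_algebra.
From mathcomp Require Import all_solvable all_field.
From mathcomp Require Import mpoly.
From mathcomp Require Import ring zify.
From Stdlib Require Import Classical.

Set Implicit Arguments.
Unset Strict Implicit.
Unset Printing Implicit Defensive.

Import GRing.Theory.
Local Open Scope ring_scope.

(** Conjugating by [g], everything happens on the diagonal torus, on which the
    Frobenius map acts as the [q]-th power followed by the signed permutation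
    [w].  An element fixed by it amounts to the choice, on each cycle of [w], of
    one value [z]: going along the cycle raises to the power [q], so that
    [z ^ (q ^ l) = z] on a pair of opposite cycles of length [l], and
    [z ^ (q ^ m) = z^-1] on a cycle of length [2 m] stable under inversion.  Take
    for [z] a primitive root of unity of order [q ^ l - 1], respectively
    [q ^ m + 1].  These orders are so large that, even after squaring, no smaller
    power of [q] fixes or inverts [z] ([no_early_period_minus],
    [no_early_period_plus]), hence [z] determines the length of its cycle and the
    entries [s i], as well as their squares, satisfy [s i <> s j] and
    [s i * s j <> 1] for all [i <> j] ([entries_separated],
    [entries_from_seeds]).  When two stable cycles have length 2, the value 1 is
    used on one of them.

    In the symplectic group [diag (s, s^-1)] has distinct eigenvalues, and
    commuting with it means being diagonal ([sp_centraliser]).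

    For the spin groups, let [h c] (here [torus_elt]) be the operator acting on
    the basis vector [e_S] of the spin module by the product of the [c i] for [i] in [S] and of
    the [(c i)^-1] for [i] not in [S]; it lies over the diagonal matrix with
    entries [c i ^ 2].  An element [x] of the spin group over the diagonal matrix
    with entries [a] is some [h c] with [c i ^ 2 = a i] ([torus_lift]), so
    [x ^ 2 = h a] depends on [a] only.  With [x] over the matrix with entries
    [s], this shows that [h s = x ^ 2] is fixed by Frobenius ([spin_fixed]),
    whatever the parity of [q]; [h s] lies over the squares of the [s i], and this
    is why the roots of unity are squared above.

    The centraliser of [h s] in the spin group is exactly the diagonal torus
    ([centraliser_covers]).  An element [x] of it can only permute the lines of
    the hyperbolic pairs, exchanging [e_i] and [f_i] for some of the [i] with
    [a i = 1] or [a i = -1], where [a i = s i ^ 2].  There are at most two such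
    [i], and by parity exactly two if there is one; then [x] multiplies the
    eigenvalue of [h s] by [1 * -1], so it does not commute with [h s].  The
    orthogonal space of dimension [2 n + 1] is handled inside the hyperbolic
    space of dimension [2 n + 2] by adding an entry equal to 1.

    Thus the whole centraliser, and not only its identity component, lies in the
    torus.  Conversely each point of the torus is joined to 1 by a rational
    curve, which is irreducible, so the torus is connected
    ([torus_identity_component]). *)

(** * The spin module *)

Section SpinModule.
Variables (K : fieldType) (k : nat).
Implicit Types (i j : 'I_k) (S R C : {set 'I_k}) (M N : 'M[K]_(spin_dim k)).

Definition flip i S : {set 'I_k} := [set j | (j == i) (+) (j \in S)].

Lemma in_flip i j S : (j \in flip i S) = (j == i) (+) (j \in S).
Proof. by rewrite inE. Qed.

Lemma flipK i : involutive (flip i).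
Proof. by move=> S; apply/setP=> j; rewrite !in_flip addbA addbb. Qed.

Lemma flipC i j S : flip i (flip j S) = flip j (flip i S).
Proof. by apply/setP=> l; rewrite !in_flip addbCA. Qed.

Lemma flip_eq i R C : (flip i R == C) = (R == flip i C).
Proof. by apply/eqP/eqP=> [<-|->]; rewrite flipK. Qed.

Lemma card_flip i S : odd #|flip i S| = ~~ odd #|S|.
Proof.
have [iS|iS] := boolP (i \in S).
  rewrite (cardsD1 i S) iS /= negbK; congr (odd #|pred_of_set _|).
  by apply/setP=> j; rewrite !inE; case: eqP => // ->; rewrite iS.
have -> : flip i S = i |: S.
  by apply/setP=> j; rewrite !inE; case: eqP => // ->; rewrite (negbTE iS).
by rewrite cardsU1 iS.
Qed.

(** Matrices on the spin module have their rows and columns indexed by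
    numbered subsets; coefficients are easier to handle indexed by the subsets
    themselves. *)
Definition coef M R C : K := M (enum_rank R) (enum_rank C).

Lemma coefP M N : (forall R C, coef M R C = coef N R C) -> M = N.
Proof.
move=> eqMN; apply/matrixP=> r c.
by have := eqMN (enum_val r) (enum_val c); rewrite /coef !enum_valK.
Qed.

Lemma coef_mul M N R C : coef (M *m N) R C = \sum_T coef M R T * coef N T C.
Proof.
rewrite /coef mxE (reindex enum_rank) //=.
by exists enum_val => x _; rewrite ?enum_valK ?enum_rankK.
Qed.

Lemma coefD M N R C : coef (M + N) R C = coef M R C + coef N R C.
Proof. by rewrite /coef mxE. Qed.

Lemma coefN M R C : coef (- M) R C = - coef M R C.
Proof. by rewrite /coef mxE. Qed.

Lemma coefZ a M R C : coef (a *: M) R C = a * coef M R C.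
Proof. by rewrite /coef mxE. Qed.

Lemma coef_tr M R C : coef M^T R C = coef M C R.
Proof. by rewrite /coef mxE. Qed.

Lemma coef_scalar a R C : coef a%:M R C = a *+ (R == C).
Proof. by rewrite /coef mxE (inj_eq enum_rank_inj). Qed.

Lemma coef0 R C : coef 0 R C = 0.
Proof. by rewrite /coef mxE. Qed.

Lemma coef_sum I (r : seq I) (F : I -> 'M[K]_(spin_dim k)) R C :
  coef (\sum_(x <- r) F x) R C = \sum_(x <- r) coef (F x) R C.
Proof. by rewrite /coef summxE. Qed.

Definition of_coef (f : {set 'I_k} -> {set 'I_k} -> K) : 'M[K]_(spin_dim k) :=
  \matrix_(r, c) f (enum_val r) (enum_val c).

Lemma coef_of_coef f R C : coef (of_coef f) R C = f R C.
Proof. by rewrite /coef mxE !enum_rankK. Qed.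

Local Notation sgn := (wedge_sign K).

Lemma sgn_sqr i S : sgn i S * sgn i S = 1.
Proof. by rewrite /wedge_sign -expr2 sqrr_sign. Qed.

Lemma sgn_flip i j S :
  sgn i (flip j S) = if (j < i)%N then - sgn i S else sgn i S.
Proof.
rewrite /wedge_sign; have [ji|ij] := ltnP.
  have -> : [set l in flip j S | (l < i)%N] = flip j [set l in S | (l < i)%N].
    by apply/setP=> l; rewrite !inE; case: eqP => // ->; rewrite ji !andbT.
  rewrite -[LHS]signr_odd card_flip -[in RHS]signr_odd.
  by case: (odd _); rewrite ?expr0 ?expr1 ?opprK.
congr (_ ^+ #|pred_of_set _|); apply/setP=> l; rewrite !inE.
by case: eqP => // ->; rewrite ltnNge ij !andbF.
Qed.

(** The creation and annihilation operators are treated together: both send a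
    basis vector [e_S] to a multiple of [e_(flip i S)]. *)
Definition gen (d : bool) i : 'M[K]_(spin_dim k) :=
  if d then annihilate K i else create K i.

Lemma coef_gen d i R C :
  coef (gen d i) R C = if ((i \in C) == d) && (R == flip i C) then sgn i C else 0.
Proof.
have E (S T : {set 'I_k}) : (i \notin T) && (S == i |: T) = (i \notin T) && (S == flip i T).
  case: (boolP (i \in T)) => //= iT; congr (S == _).
  by apply/setP=> j; rewrite !inE; case: eqP => // ->; rewrite (negbTE iT).
case: d; rewrite /gen /annihilate ?coef_tr /create /coef mxE !enum_rankK E.
  rewrite -flip_eq [flip _ _ == _]eq_sym andbC [_ && (R == _)]andbC; case: eqP => // ->.
  by rewrite in_flip eqxx eqb_id /= negbK sgn_flip ltnn.
by case: (i \in C).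
Qed.

(** As [gen d i] is a signed partial permutation of the basis, multiplying by it
    moves the coefficients of a matrix without any summation. *)
Lemma coef_genl d i M R C :
  coef (gen d i *m M) R C =
    if (i \in R) == d then 0 else sgn i R * coef M (flip i R) C.
Proof.
rewrite coef_mul (bigD1 (flip i R)) //= big1 ?addr0 => [|T neT].
  rewrite coef_gen flipK eqxx andbT in_flip eqxx sgn_flip ltnn.
  by case: (i \in R) d => [] []; rewrite //= ?mul0r.
by rewrite coef_gen -flip_eq [flip _ _ == _]eq_sym (negbTE neT) andbF mul0r.
Qed.

Lemma coef_genr d i M R C :
  coef (M *m gen d i) R C =
    if (i \in C) == d then sgn i C * coef M R (flip i C) else 0.
Proof.
rewrite coef_mul (bigD1 (flip i C)) //= big1 ?addr0 => [|T neT].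
  by rewrite coef_gen eqxx andbT; case: ifP; rewrite ?mulr0 // mulrC.
by rewrite coef_gen (negbTE neT) andbF mulr0.
Qed.

Lemma gen_tr d i : (gen d i)^T = gen (~~ d) i.
Proof. by case: d; rewrite /gen /annihilate ?trmxK. Qed.

Lemma gen_anticomm d d' i j : i != j ->
  gen d i *m gen d' j = - (gen d' j *m gen d i).
Proof.
move=> ij; apply: coefP => R C; rewrite coefN coef_genl coef_genr !coef_gen.
rewrite flip_eq in_flip (negbTE (_ : j != i)) 1?eq_sym //= [flip j (flip i C)]flipC.
case: (R =P _) => [->|_]; last by rewrite !andbF !mulr0 !if_same oppr0.
rewrite !in_flip eqxx (negbTE ij) /= !andbT !sgn_flip ltnn.
have := ij; rewrite -val_eqE neq_ltn => /orP[] lt_ij; rewrite lt_ij ltnNge ltnW //=;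
by case: (_ \in C) d => [] []; case: (_ \in C) d' => [] [] /=; rewrite ?mulr0 ?oppr0 //; ring.
Qed.

Lemma gen_sqr d i : gen d i *m gen d i = 0.
Proof.
apply: coefP => R C; rewrite coef_genl coef_gen flip_eq coef0.
case: (R =P _) => [->|_]; last by rewrite andbF mulr0 if_same.
by rewrite flipK; case: (_ == _); rewrite //= mulr0.
Qed.

Lemma coef_occupied d i R C :
  coef (gen d i *m gen (~~ d) i) R C = (((i \in R) != d) && (R == C))%:R.
Proof.
rewrite coef_genl coef_gen -flip_eq flipK; case: (R =P C) => [<-|_]; last first.
  by rewrite !andbF mulr0 if_same.
rewrite andbT.
by case: (i \in R) d => [] [] //=; rewrite sgn_sqr.
Qed.

(** [gen d i *m gen (~~ d) i] is the projection onto the span of the [e_S] such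
    that [i] belongs to [S] (for [d = false]) or does not (for [d = true]). *)
Lemma gen_comp d i : gen d i *m gen (~~ d) i + gen (~~ d) i *m gen d i = 1%:M.
Proof.
apply: coefP => R C; rewrite coefD coef_occupied.
have := coef_occupied (~~ d) i R C; rewrite negbK => ->.
rewrite coef_scalar; case: (R =P C) => _; rewrite ?andbF ?addr0 // !andbT.
by case: (i \in R) d => [] [] //=; rewrite ?add0r ?addr0.
Qed.

(** The vector with coordinates [f i] and [g i] along the hyperbolic pair
    [(e_i, f_i)], seen in the Clifford algebra. *)
Definition cvec (f g : 'I_k -> K) : 'M[K]_(spin_dim k) :=
  \sum_i (f i *: create K i + g i *: annihilate K i).

Lemma eq_cvec f g f' g' : f =1 f' -> g =1 g' -> cvec f g = cvec f' g'.
Proof. by move=> ef eg; apply: eq_bigr => i _; rewrite ef eg. Qed.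

Lemma cvecD f g f' g' :
  cvec f g + cvec f' g' = cvec (fun i => f i + f' i) (fun i => g i + g' i).
Proof. by rewrite -big_split; apply: eq_bigr => i _; rewrite !scalerDl addrACA. Qed.

Lemma cvecZ a f g : a *: cvec f g = cvec (fun i => a * f i) (fun i => a * g i).
Proof. by rewrite scaler_sumr; apply: eq_bigr => i _; rewrite scalerDr !scalerA. Qed.

(** The cross terms cancel in pairs, in characteristic 2 as well. *)
Lemma anticommuting_sum_sqr (m : nat) (I : eqType) (r : seq I) (x : I -> 'M[K]_m) :
    uniq r -> (forall i j : I, i != j -> x i *m x j = - (x j *m x i)) ->
  (\sum_(i <- r) x i) *m (\sum_(i <- r) x i) = \sum_(i <- r) x i *m x i.
Proof.
move=> + anti; elim: r => [|i r IH] /=; first by rewrite !big_nil mul0mx.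
case/andP=> ir /IH {}IH; rewrite !big_cons mulmxDl !mulmxDr IH.
have -> : x i *m (\sum_(j <- r) x j) = - ((\sum_(j <- r) x j) *m x i).
  rewrite mulmx_sumr mulmx_suml -sumrN !big_seq; apply: eq_bigr => j jr.
  by apply: anti; apply: contraNneq ir => ->.
by rewrite addrA addrNK.
Qed.

Lemma cvec_sqr f g : cvec f g *m cvec f g = (\sum_i f i * g i)%:M.
Proof.
rewrite anticommuting_sum_sqr ?index_enum_uniq // => [|i j ij].
  rewrite (raddf_sum (@scalar_mx _ _)); apply: eq_bigr => i _.
  rewrite mulmxDl !mulmxDr -!scalemxAl -!scalemxAr.
  rewrite (gen_sqr false) (gen_sqr true) !scaler0 add0r addr0 !scalerA.
  by rewrite [g i * _]mulrC -scalerDr (gen_comp false) scalemx1.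
rewrite !mulmxDl !mulmxDr -!scalemxAl -!scalemxAr !scalerA.
rewrite !opprD (gen_anticomm false false ij) (gen_anticomm false true ij).
rewrite (gen_anticomm true false ij) (gen_anticomm true true ij) !scalerN.
by rewrite [g j * g i]mulrC [f j * f i]mulrC [f j * g i]mulrC [g j * f i]mulrC addrACA.
Qed.

Lemma coef_cvec f g R C :
  coef (cvec f g) R C =
    \sum_i (if R == flip i C then sgn i C * (if i \in C then g i else f i) else 0).
Proof.
rewrite coef_sum; apply: eq_bigr => i _.
rewrite coefD !coefZ -/(gen false i) -/(gen true i) !coef_gen.
by case: (i \in C) => /=; case: eqP => _; rewrite ?mulr0 ?addr0 ?add0r 1?mulrC.
Qed.

Lemma cvec_flip f g i C :
  coef (cvec f g) (flip i C) C = sgn i C * (if i \in C then g i else f i).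
Proof.
rewrite coef_cvec (bigD1 i) //= eqxx big1 ?addr0 // => j ji; rewrite ifN //.
by apply: contraNneq ji => /setP/(_ i); rewrite !in_flip eqxx; case: eqP => [->|_] //; case: (_ \in C).
Qed.

Lemma cvec_inj f g f' g' : cvec f g = cvec f' g' -> f =1 f' /\ g =1 g'.
Proof.
move=> E; have sg i C : sgn i C != 0 by rewrite signr_eq0.
split=> i.
  have := congr1 (fun M => coef M (flip i set0) set0) E.
  by rewrite !cvec_flip inE; apply: mulfI.
have := congr1 (fun M => coef M (flip i setT) setT) E.
by rewrite !cvec_flip inE; apply: mulfI.
Qed.

Lemma cvec_odd f g R C : odd #|R| = odd #|C| -> coef (cvec f g) R C = 0.
Proof.
move=> eqRC; rewrite coef_cvec big1 // => i _; rewrite ifN //.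
by apply/eqP=> RC; move: eqRC; rewrite RC card_flip; case: (odd _).
Qed.

Lemma cvec_delta_gen d i : gen d i = cvec (fun j => ((j == i) && ~~ d)%:R) (fun j => ((j == i) && d)%:R).
Proof.
rewrite /cvec (bigD1 i) //= big1 ?addr0 => [|j /negbTE ->]; last by rewrite !scale0r addr0.
by rewrite eqxx; case: d; rewrite /gen !scale1r !scale0r ?addr0 ?add0r.
Qed.

(** The matrix of the bilinear form on the spin module for which every vector
    of the Clifford algebra is self-adjoint.  Comparing the signs of [e_i] on
    [e_S] and of [f_i] on the complementary subsets forces the factor [(-1) ^ i]
    for each [i] in [S]. *)
Definition spin_form : 'M[K]_(spin_dim k) :=
  of_coef (fun R C => if R == ~: C then \prod_(i in C) (-1) ^+ i else 0).

Lemma setC_flip i S : ~: flip i S = flip i (~: S).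
Proof. by apply/setP=> j; rewrite !inE addbN. Qed.

Lemma sgn_setC i S : sgn i (~: S) = (-1) ^+ i * sgn i S.
Proof.
rewrite /wedge_sign -[in RHS]signr_odd -[_ ^+ #|[set _ in S | _]|]signr_odd -[LHS]signr_odd.
have E : (#|[set j in ~: S | (j < i)%N]| + #|[set j in S | (j < i)%N]| = i)%N.
  rewrite -cardsUI.
  have -> : [set j in ~: S | (j < i)%N] :&: [set j in S | (j < i)%N] = set0.
    by apply/setP=> j; rewrite !inE; case: (j \in S); rewrite ?andbF.
  have -> : [set j in ~: S | (j < i)%N] :|: [set j in S | (j < i)%N] = [set j : 'I_k | (j < i)%N].
    by apply/setP=> j; rewrite !inE; case: (j \in S); rewrite ?orbF.
  rewrite cards0 addn0 cardsE cardE.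
  transitivity (size (iota 0 i)); last by rewrite size_iota.
  rewrite -(size_map val); apply: perm_size; apply: uniq_perm.
  - by rewrite map_inj_uniq ?enum_uniq //; apply: val_inj.
  - exact: iota_uniq.
  move=> l; rewrite mem_iota /=; apply/mapP/idP => [[j]|li].
    by rewrite mem_enum => ? ->.
  by exists (Ordinal (ltn_trans li (ltn_ord i))); rewrite ?mem_enum.
have := congr1 odd E; rewrite oddD => <-.
by case: (odd _); case: (odd _); rewrite /= ?expr0 ?expr1 ?mulrNN ?mulr1 ?mul1r.
Qed.

Lemma prod_flip (a : 'I_k -> K) i S : i \notin S ->
  \prod_(j in flip i S) a j = a i * \prod_(j in S) a j.
Proof.
move=> iS; rewrite (bigD1 i) /=; last by rewrite in_flip eqxx (negbTE iS).
congr (_ * _); apply: eq_bigl => j; rewrite in_flip; case: eqP => [->|_].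
  by rewrite (negbTE iS) andbF.
by rewrite andbT.
Qed.

Lemma gen_form d i : gen d i *m spin_form = spin_form *m (gen d i)^T.
Proof.
apply: coefP => R C; rewrite gen_tr coef_genl coef_genr !coef_of_coef.
rewrite flip_eq setC_flip; case: (R =P _) => [->|_]; last by rewrite !mulr0 !if_same.
rewrite in_flip eqxx inE sgn_flip ltnn sgn_setC.
case: (boolP (i \in C)) => iC; case: d => //=.
  have jC : i \notin flip i C by rewrite in_flip eqxx iC.
  rewrite -{2}[C](flipK i) prod_flip //.
  by rewrite mulrACA -signr_odd -expr2 sqrr_sign mul1r.
by rewrite prod_flip // mulrCA mulrA.
Qed.

Lemma cvec_form f g : cvec f g *m spin_form = spin_form *m (cvec f g)^T.
Proof.
rewrite /cvec raddf_sum mulmx_suml mulmx_sumr; apply: eq_bigr => i _.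
rewrite mulmxDl raddfD /= mulmxDr -!scalemxAl ![in RHS]linearZ /=.
by rewrite (gen_form false) (gen_form true).
Qed.

Definition spin_diag (d : {set 'I_k} -> K) := of_coef (fun R C => d C *+ (R == C)).

Lemma coef_diagl d M R C : coef (spin_diag d *m M) R C = d R * coef M R C.
Proof.
rewrite coef_mul (bigD1 R) //= big1 ?addr0 => [|T neT]; rewrite coef_of_coef ?eqxx //.
by rewrite eq_sym (negbTE neT) mul0r.
Qed.

Lemma coef_diagr d M R C : coef (M *m spin_diag d) R C = coef M R C * d C.
Proof.
rewrite coef_mul (bigD1 C) //= big1 ?addr0 => [|T neT]; rewrite coef_of_coef ?eqxx //.
by rewrite (negbTE neT) mulr0.
Qed.

End SpinModule.

(** * Spin groups *)

HB.instance Definition _ (R : pzSemiRingType) (m : nat) :=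
  Monoid.isLaw.Build 'M[R]_m 1%:M mulmx
    (@mulmxA R m m m m) (@mul1mx R m m) (@mulmx1 R m m).

Section SpinGroup.
Variables (K : fieldType) (n b : nat).
Implicit Types (v u : 'cV[K]_(n + n + b)) (x y : 'M[K]_(spin_dim (n + b))).
Implicit Types (f g : 'I_(n + b) -> K) (R C S : {set 'I_(n + b)}).

(** Coordinates in the hyperbolic space of dimension [2 (n + b)], in which the
    orthogonal space is the subspace where the two coordinates along each of the
    last [b] pairs agree. *)
Definition xcoord v (i : 'I_(n + b)) : K :=
  match split i with
  | inl j => v (lshift b (lshift n j)) 0
  | inr j => v (rshift (n + n) j) 0
  end.

Definition ycoord v (i : 'I_(n + b)) : K :=
  match split i with
  | inl j => v (lshift b (rshift n j)) 0
  | inr j => v (rshift (n + n) j) 0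
  end.

Lemma split_lshift p q (i : 'I_p) : split (lshift q i) = inl i.
Proof. exact: (unsplitK (inl i)). Qed.

Lemma split_rshift p q (i : 'I_q) : split (rshift p i) = inr i.
Proof. exact: (unsplitK (inr i)). Qed.

Lemma cliffordE v : clifford v = cvec (xcoord v) (ycoord v).
Proof.
rewrite /clifford /cvec big_split_ord /=; congr (_ + _); apply: eq_bigr => i _.
  by rewrite /xcoord /ycoord split_lshift.
by rewrite /xcoord /ycoord split_rshift scalerDr.
Qed.

Lemma qformE v : qform v = \sum_i xcoord v i * ycoord v i.
Proof.
rewrite /qform big_split_ord /=; congr (_ + _); apply: eq_bigr => i _.
  by rewrite /xcoord /ycoord split_lshift.
by rewrite /xcoord /ycoord split_rshift expr2.
Qed.

Definition vec_of f g : 'cV[K]_(n + n + b) :=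
  col_mx (col_mx (\col_i f (lshift b i)) (\col_i g (lshift b i)))
         (\col_j f (rshift n j)).

Lemma clifford_vec f g :
  (forall j : 'I_b, f (rshift n j) = g (rshift n j)) ->
  clifford (vec_of f g) = cvec f g.
Proof.
move=> fg; rewrite cliffordE; apply: eq_cvec => i; case: (split_ordP i) => j ->;
by rewrite /xcoord /ycoord ?split_lshift ?split_rshift
  ?col_mxEu ?col_mxEd ?(col_mxEu, col_mxEd) mxE ?fg.
Qed.

Lemma cliffordD v u : clifford (v + u) = clifford v + clifford u.
Proof.
by rewrite !cliffordE cvecD; apply: eq_cvec => i;
  rewrite /xcoord /ycoord; case: split => j; rewrite !mxE.
Qed.

Lemma cliffordZ (a : K) v : clifford (a *: v) = a *: clifford v.
Proof.
by rewrite !cliffordE cvecZ; apply: eq_cvec => i;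
  rewrite /xcoord /ycoord; case: split => j; rewrite !mxE.
Qed.

Lemma clifford_sqr v : clifford v *m clifford v = (qform v)%:M.
Proof. by rewrite cliffordE cvec_sqr qformE. Qed.

(** Conjugation by a vector of norm 1 is the opposite of a reflection. *)
Lemma clifford_normal v u : qform v = 1 ->
  exists u', clifford v *m clifford u = clifford u' *m clifford v.
Proof.
move=> qv; pose c := qform (v + u) - qform v - qform u.
have vu : clifford v *m clifford u = c%:M - clifford u *m clifford v.
  rewrite /c !raddfB /= -!clifford_sqr cliffordD.
  move: (clifford v) (clifford u) => A B; rewrite mulmxDl !mulmxDr.
  by apply/esym/eqP; rewrite !subr_eq -!addrA addrC !addrA.
exists (c *: v + -1 *: u).
rewrite vu cliffordD !cliffordZ scaleN1r mulmxBl -scalemxAl clifford_sqr qv.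
by rewrite scalemx1.
Qed.

Lemma spin1 : spin (1%:M : 'M[K]_(spin_dim (n + b))).
Proof. by exists [::]; rewrite big_nil. Qed.

Lemma spinM x y : spin x -> spin y -> spin (x *m y).
Proof.
move=> [s [os qs ->]] [t [ot qt ->]]; exists (s ++ t); rewrite big_cat; split=> //.
  by rewrite size_cat oddD (negbTE os) (negbTE ot).
by rewrite all_cat qs qt.
Qed.

Lemma spin_clifford2 v u : qform v = 1 -> qform u = 1 ->
  spin (clifford v *m clifford u).
Proof.
move=> qv qu; exists [:: v; u]; rewrite !big_cons big_nil mulmx1; split=> //.
by rewrite /= qv qu eqxx.
Qed.

(** Reversing the order of the vectors gives the inverse. *)
Lemma spin_inv x : spin x -> exists y, [/\ spin y, x *m y = 1%:M & y *m x = 1%:M].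
Proof.
case=> s [os qs ->].
exists (\big[mulmx/1%:M]_(v <- rev s) clifford v); split.
- by exists (rev s); rewrite size_rev all_rev; split.
- elim: {os} s qs => [|v s IH]; first by rewrite !big_nil mul1mx.
  case/andP=> /eqP qv /IH {}IH; rewrite rev_cons big_rcons big_cons /=.
  by rewrite -mulmxA [X in _ *m X]mulmxA IH mul1mx clifford_sqr qv.
elim: {os} s qs => [|v s IH]; first by rewrite !big_nil mul1mx.
case/andP=> /eqP qv /IH {}IH; rewrite rev_cons big_rcons big_cons /=.
by rewrite mulmxA -[X in X *m _]mulmxA clifford_sqr qv mulmx1.
Qed.

Lemma spin_unit x : spin x -> x \in unitmx.
Proof. by case/spin_inv=> y [_ /mulmx1_unit[]]. Qed.

Lemma spinV x : spin x -> spin (invmx x).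
Proof.
move=> sx; have [y [sy xy _]] := spin_inv sx.
by rewrite -[invmx x]mulmx1 -xy mulKmx ?spin_unit.
Qed.

Lemma spin_normal x u : spin x -> exists u', x *m clifford u = clifford u' *m x.
Proof.
case=> s [_ qs ->]; elim: s qs => [|v s IH] /=.
  by exists u; rewrite big_nil mul1mx mulmx1.
case/andP=> /eqP qv /IH[u' xu]; have [u'' vu'] := clifford_normal u' qv.
by exists u''; rewrite big_cons -mulmxA xu mulmxA vu' -mulmxA.
Qed.

(** Each factor is self-adjoint and has square 1. *)
Lemma spin_preserves_form x :
  spin x -> x *m spin_form K (n + b) *m x^T = spin_form K (n + b).
Proof.
case=> s [_ qs ->]; elim: s qs => [|v s IH] /=.
  by rewrite big_nil trmx1 mul1mx mulmx1.
case/andP=> /eqP qv /IH {}IH; rewrite big_cons trmx_mul.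
set y := bigop _ _ _ in IH *.
rewrite -!mulmxA [X in _ *m X]mulmxA [X in _ *m X]mulmxA IH.
by rewrite cliffordE -cvec_form mulmxA -cliffordE clifford_sqr qv mul1mx.
Qed.

(** A vector changes the parity of the degree in the exterior algebra. *)
Lemma spin_even x R C : spin x -> odd #|R| != odd #|C| -> coef x R C = 0.
Proof.
case=> s [os _ ->]; rewrite -[odd #|R|]addbF -(negbTE os) {os}.
elim: s R => [|v s IH] R /=; rewrite ?big_nil ?big_cons.
  by rewrite coef_scalar addbF; have [->|] := eqVneq R C; rewrite ?eqxx.
move=> neq; rewrite coef_mul big1 // => T _; rewrite cliffordE.
have [eqRT|neRT] := eqVneq (odd #|R|) (odd #|T|); first by rewrite cvec_odd ?mul0r.
rewrite IH ?mulr0 //; move: neq neRT.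
by do 4!case: (odd _).
Qed.

(** For [b = 1] this is, up to a scalar, the product of an orthogonal basis of
    the orthogonal space when the characteristic is odd, which is central in
    the Clifford algebra since the dimension is odd. *)
Definition volume (j : 'I_b) : 'M[K]_(spin_dim (n + b)) :=
  of_coef (fun R C => (R == flip (rshift n j) C)%:R).

Lemma coef_volumel j x R C : coef (volume j *m x) R C = coef x (flip (rshift n j) R) C.
Proof.
rewrite coef_mul (bigD1 (flip (rshift n j) R)) //= big1 ?addr0 => [|T neT].
  by rewrite coef_of_coef flipK eqxx mul1r.
by rewrite coef_of_coef -flip_eq [flip _ _ == _]eq_sym (negbTE neT) mul0r.
Qed.

Lemma coef_volumer j x R C : coef (x *m volume j) R C = coef x R (flip (rshift n j) C).
Proof.
rewrite coef_mul (bigD1 (flip (rshift n j) C)) //= big1 ?addr0 => [|T neT].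
  by rewrite coef_of_coef eqxx mulr1.
by rewrite coef_of_coef (negbTE neT) mulr0.
Qed.

Lemma volume_central j v : (b <= 1)%N ->
  volume j *m clifford v = clifford v *m volume j.
Proof.
move=> b1; apply: coefP => R C; rewrite coef_volumel coef_volumer cliffordE !coef_cvec.
apply: eq_bigr => i _; rewrite flip_eq flipC; case: eqP => // _.
case: (split_ordP i) => l -> {i}; rewrite sgn_flip in_flip.
  by rewrite ltnNge ltnW ?eq_lrshift //= ltn_addr.
have -> : l = j by apply/val_inj; case: l j b1 => ? + [? +] /=; lia.
by rewrite ltnn /xcoord /ycoord split_rshift !if_same.
Qed.

Lemma spin_volume j x : (b <= 1)%N -> spin x -> volume j *m x = x *m volume j.
Proof.
move=> b1 [s [_ _ ->]]; elim: s => [|v s IH]; first by rewrite big_nil mulmx1 mul1mx.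
by rewrite big_cons mulmxA volume_central // -mulmxA IH mulmxA.
Qed.

(** The weights of the spin representation: [c i] is a square root of the entry
    of the orthogonal matrix at [e_i]. *)
Definition weight (c : 'I_(n + b) -> K) S : K :=
  \prod_i (if i \in S then c i else (c i)^-1).

Definition torus_elt (c : 'I_(n + b) -> K) := spin_diag (weight c).

Definition extend (c : 'I_n -> K) (i : 'I_(n + b)) : K :=
  match split i with inl j => c j | inr _ => 1 end.

Lemma extendl c i : extend c (lshift b i) = c i.
Proof. by rewrite /extend split_lshift. Qed.

Lemma extendr c j : extend c (rshift n j) = 1.
Proof. by rewrite /extend split_rshift. Qed.

Lemma extend_neq0 c : (forall i, c i != 0) -> forall i, extend c i != 0.
Proof. by move=> nzc i; rewrite /extend; case: split => // _; apply: oner_neq0. Qed.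

Lemma weight_flip c i S : c i != 0 ->
  weight c (flip i S) = weight c S * (if i \in S then (c i) ^- 2 else c i ^+ 2).
Proof.
move=> nzc; rewrite /weight (bigD1 i) //= [in RHS](bigD1 i) //= in_flip eqxx.
rewrite [X in _ * X = _](eq_bigr (fun j => if j \in S then c j else (c j)^-1)).
  by case: (i \in S) => /=; field.
by move=> j ji; rewrite in_flip (negbTE ji).
Qed.

Lemma weightM c d S : weight (fun i => c i * d i) S = weight c S * weight d S.
Proof.
by rewrite /weight -big_split; apply: eq_bigr => i _; case: ifP => // _; rewrite invfM.
Qed.

Lemma spin_diagM (d e : {set 'I_(n + b)} -> K) :
  spin_diag d *m spin_diag e = spin_diag (fun S => d S * e S).
Proof.
apply: coefP => R C; rewrite coef_diagl !coef_of_coef.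
by case: eqP => [->|_]; rewrite ?mulr0.
Qed.

Lemma eq_spin_diag (d e : {set 'I_(n + b)} -> K) : d =1 e -> spin_diag d = spin_diag e.
Proof. by move=> de; apply: coefP => R C; rewrite !coef_of_coef de. Qed.

Lemma eq_torus_elt c d : c =1 d -> torus_elt c = torus_elt d.
Proof.
by move=> cd; apply: eq_spin_diag => S; apply: eq_bigr => i _; rewrite cd.
Qed.

Lemma torus_eltM c d : torus_elt c *m torus_elt d = torus_elt (fun i => c i * d i).
Proof. by rewrite spin_diagM; apply: eq_spin_diag => S; rewrite weightM. Qed.

Lemma torus_elt1 : torus_elt (fun=> 1) = 1%:M.
Proof.
apply: coefP => R C; rewrite coef_of_coef coef_scalar /weight big1 // => i _.
by rewrite invr1 if_same.
Qed.

Lemma torus_normal c f g : (forall i, c i != 0) ->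
  torus_elt c *m cvec f g =
  cvec (fun i => c i ^+ 2 * f i) (fun i => (c i) ^- 2 * g i) *m torus_elt c.
Proof.
move=> nzc; apply: coefP => R C; rewrite coef_diagl coef_diagr !coef_cvec.
rewrite mulr_sumr mulr_suml; apply: eq_bigr => i _; case: eqP => [->|]; last first.
  by rewrite mulr0 mul0r.
rewrite weight_flip //; case: ifP => _; ring.
Qed.

Lemma clifford_diag_entries (a : 'I_n -> K) v :
  clifford (diag_entries b a *m v) =
  cvec (fun i => extend a i * xcoord v i) (fun i => (extend a i)^-1 * ycoord v i).
Proof.
rewrite cliffordE; apply: eq_cvec => i; case: (split_ordP i) => j ->;
by rewrite /xcoord /ycoord /extend /diag_entries mul_diag_mx
     !(mxE, split_lshift, split_rshift) ?invr1.
Qed.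

Lemma torus_covers (c a : 'I_n -> K) : (forall i, c i != 0) ->
  (forall i, c i ^+ 2 = a i) -> spin_covers (torus_elt (extend c)) (diag_entries b a).
Proof.
move=> nzc ca v; rewrite clifford_diag_entries cliffordE torus_normal; last exact: extend_neq0.
congr (_ *m _); apply: eq_cvec => i; rewrite /extend; case: split => j;
by rewrite ?ca // expr1n ?invr1.
Qed.

End SpinGroup.

(** * Diagonal elements of spin groups *)

Section SpinTorus.
Variables (K : fieldType) (n b : nat).
Hypothesis b1 : (b <= 1)%N.
Implicit Types (x y : 'M[K]_(spin_dim (n + b))) (R C S : {set 'I_(n + b)}).
Implicit Types (a c s : 'I_n -> K).

Local Notation gen := (@gen K (n + b)).
Local Notation ext := (@extend K n b).

Lemma ord_b_unique (i j : 'I_b) : i = j.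
Proof. by apply/val_inj; case: i j b1 => ? + [? +] /=; lia. Qed.

(** The last coordinate is determined by the others and the parity. *)
Lemma set_parity_inj R C :
    (forall i : 'I_n, (lshift b i \in R) = (lshift b i \in C)) ->
  odd #|R| = odd #|C| -> R = C.
Proof.
move=> eqRC pRC.
have [//|neq] := eqVneq R C.
have /existsP[i] : [exists i, (i \in R) != (i \in C)].
  apply: contra_neqT neq => /existsPn H; apply/setP=> i.
  by have := H i; rewrite negbK => /eqP.
case: (split_ordP i) => j -> {i} neqj; first by rewrite eqRC eqxx in neqj.
suff RC : R = flip (rshift n j) C by move: pRC; rewrite RC card_flip; case: (odd _).
apply/setP=> i; rewrite in_flip; case: (split_ordP i) => l -> {i}.
  by rewrite eq_lrshift eqRC.
by rewrite (ord_b_unique l j) eqxx; move: neqj; do 2!case: (_ \in _).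
Qed.

(** Used with [e = d] when [x] preserves the lines of [e_i] and [f_i], and with
    [e <> d] when it exchanges them: [x] then maps [e_C] to vectors [e_R] for
    which membership of [i] is preserved, respectively reversed. *)
Lemma coef_occ_comm x R C (d e : bool) i :
  x *m (gen d i *m gen (~~ d) i) = (gen e i *m gen (~~ e) i) *m x ->
  coef x R C != 0 -> (i \in R) = (i \in C) (+) d (+) e.
Proof.
have occE d' : gen d' i *m gen (~~ d') i =
    spin_diag (fun S => ((i \in S) != d')%:R).
  by apply: coefP => S T; rewrite coef_occupied coef_of_coef; have [->|_] := eqVneq S T;
    rewrite ?andbT ?andbF.
rewrite !occE => /(congr1 (fun M => coef M R C)); rewrite coef_diagl coef_diagr.
move=> E nz; move: E; rewrite mulrC => /(mulIf nz) {nz}.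
have inj (p q : bool) : p%:R = q%:R :> K -> p = q.
  by case: p q => [] [] // /eqP; rewrite ?oner_eq0 // eq_sym oner_eq0.
by move/inj; move: (i \in R) (i \in C) d e => [] [] [] [].
Qed.

(** Two adjacent diagonal coefficients are related by the action on the
    corresponding hyperbolic pair. *)
Lemma coef_flip x (i : 'I_(n + b)) (r : K) S :
  x *m gen false i = r *: (gen false i *m x) -> i \notin S ->
  coef x (flip i S) (flip i S) = r * coef x S S.
Proof.
move=> /(congr1 (fun M => coef M (flip i S) S)) + iS.
rewrite coef_genr coefZ coef_genl in_flip eqxx (negbTE iS) /= flipK sgn_flip ltnn.
by rewrite mulrCA => /mulfI -> //; rewrite signr_eq0.
Qed.

(** A diagonal operator on the spin module is determined by the ratios of its
    eigenvalues at neighbouring subsets. *)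
Lemma diag_coef (d : {set 'I_(n + b)} -> K) (A : 'I_(n + b) -> K) :
  (forall i S, i \notin S -> d (flip i S) = A i * d S) ->
  forall S, d S = \prod_(i in S) A i * d set0.
Proof.
move=> dA S; have [m] := ubnP #|S|; elim: m => // m IH in S * => leS.
have [->|/set0Pn[i iS]] := eqVneq S set0; first by rewrite big_set0 mul1r.
have iS' : i \notin flip i S by rewrite in_flip eqxx iS.
rewrite -[S](flipK i) dA // IH ?(prod_flip _ iS') ?mulrA //.
suff -> : flip i S = S :\ i by rewrite (cardsD1 i S) iS in leS.
by apply/setP=> j; rewrite !inE; case: eqP => // ->; rewrite iS.
Qed.

Lemma weightE (c : 'I_(n + b) -> K) S : (forall i, c i != 0) ->
  weight c S = \prod_(i in S) c i ^+ 2 * (\prod_i c i)^-1.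
Proof.
move=> nzc; apply: (@mulIf _ (\prod_i c i)).
  by apply/prodf_neq0 => i _.
rewrite mulfVK; last by apply/prodf_neq0 => i _.
rewrite -big_split [RHS]big_mkcond; apply: eq_bigr => i _ /=.
by case: (i \in S); rewrite ?mulVf.
Qed.

Lemma ext_prod a : \prod_i ext a i = \prod_i a i.
Proof.
rewrite big_split_ord /= [X in _ * X]big1 ?mulr1 => [|j _]; last by rewrite extendr.
by apply: eq_bigr => i _; rewrite extendl.
Qed.

(** Applying [spin_covers] to the basis vectors. *)
Lemma covers_gen x a d i : spin_covers x (diag_entries b a) ->
  x *m gen d (lshift b i) =
  (if d then (a i)^-1 else a i) *: (gen d (lshift b i) *m x).
Proof.
move=> cx; pose f e := fun j : 'I_(n + b) => ((j == lshift b i) && e)%:R : K.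
have fr e j : f e (rshift n j) = 0 by rewrite /f eq_rlshift.
have E : clifford (vec_of (f (~~ d)) (f d)) = gen d (lshift b i).
  by rewrite clifford_vec ?cvec_delta_gen // => j; rewrite !fr.
have := cx (vec_of (f (~~ d)) (f d)); rewrite E clifford_diag_entries => ->.
rewrite scalemxAl -E cliffordE cvecZ; congr (_ *m _).
have xE j : xcoord (vec_of (f (~~ d)) (f d)) j = f (~~ d) j.
  have := cliffordE (vec_of (f (~~ d)) (f d)); rewrite clifford_vec => [|l]; last by rewrite !fr.
  by case/cvec_inj.
have yE j : ycoord (vec_of (f (~~ d)) (f d)) j = f d j.
  have := cliffordE (vec_of (f (~~ d)) (f d)); rewrite clifford_vec => [|l]; last by rewrite !fr.
  by case/cvec_inj.
apply: eq_cvec => j; rewrite ?xE ?yE /f.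
  by case: eqP => [->|_]; rewrite ?mulr0 // extendl; case: d {E fr xE yE f}; rewrite ?mulr0.
by case: eqP => [->|_]; rewrite ?mulr0 // extendl; case: d {E fr xE yE f}; rewrite ?mulr0.
Qed.

Lemma covers_last x a j : spin_covers x (diag_entries b a) ->
  x *m (gen false (rshift n j) + gen true (rshift n j)) =
  (gen false (rshift n j) + gen true (rshift n j)) *m x.
Proof.
move=> cx; pose f := fun l : 'I_(n + b) => (l == rshift n j)%:R : K.
have E : clifford (vec_of f f) = gen false (rshift n j) + gen true (rshift n j).
  rewrite clifford_vec // !cvec_delta_gen cvecD; apply: eq_cvec => l;
  by rewrite andbF andbT ?addr0 ?add0r.
have := cx (vec_of f f); rewrite E clifford_diag_entries => ->; rewrite -E cliffordE.
congr (_ *m _).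
have [xE yE] : xcoord (vec_of f f) =1 f /\ ycoord (vec_of f f) =1 f.
  by have := cliffordE (vec_of f f); rewrite clifford_vec // => /cvec_inj[xE yE]; split=> l.
apply: eq_cvec => l; rewrite ?xE ?yE /f; case: eqP => [->|_];
by rewrite ?mulr0 // extendr ?invr1 mulr1.
Qed.

(** Commuting with the projections attached to the first [n] pairs preserves
    membership of each [i < n]; the parity takes care of a last coordinate. *)
Lemma spin_diagonal x : spin x ->
    (forall i, x *m (gen false (lshift b i) *m gen true (lshift b i)) =
               (gen false (lshift b i) *m gen true (lshift b i)) *m x) ->
  x = spin_diag (fun S => coef x S S).
Proof.
move=> sx comm; apply: coefP => R C; rewrite coef_of_coef.
case: eqP => [->|neq] //; apply/eqP; apply: contra_notT neq => nz.
apply: set_parity_inj => [i|].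
  by rewrite (coef_occ_comm (d := false) (e := false) (comm i) nz) !addbF.
by apply/eqP; apply: contraNT nz => neq; rewrite spin_even.
Qed.

Lemma comm_occ x D (r r' : K) i : r * r' = 1 ->
    x *m gen false i = r *: (gen D i *m x) ->
    x *m gen true i = r' *: (gen (~~ D) i *m x) ->
  x *m (gen false i *m gen true i) = (gen D i *m gen (~~ D) i) *m x.
Proof.
move=> rr xe xf.
by rewrite mulmxA xe -scalemxAl -(mulmxA (gen D i) x) xf -scalemxAr scalerA rr
  scale1r mulmxA.
Qed.

End SpinTorus.

Lemma closed_sqrt (K : closedFieldType) (a : K) : exists c, c ^+ 2 = a.
Proof.
have [c] := @solve_monicpoly K 2 (fun i => if i == 0%N then a else 0) isT.
by rewrite big_ord_recl big_ord1 /= expr0 mulr1 mul0r addr0 => ?; exists c.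
Qed.

Section TorusLift.
Variables (K : closedFieldType) (n b : nat).
Hypotheses (b1 : (b <= 1)%N) (n0 : (0 < n)%N).
Implicit Types (x : 'M[K]_(spin_dim (n + b))) (a : 'I_n -> K).

Local Notation ext := (@extend K n b).

(** The elements of the spin group over a diagonal matrix are diagonal in the
    spin representation.  The spin form forces the product of the coefficients
    at a subset and at its complement to be 1, which leaves two choices. *)
Lemma torus_lift x a : spin x -> (forall i, a i != 0) ->
    spin_covers x (diag_entries b a) ->
  exists c, [/\ forall i, c i != 0, forall i, c i ^+ 2 = a i & x = torus_elt (ext c)].
Proof.
move=> sx nza cx.
have nzA i : ext a i != 0 by apply: extend_neq0.
have xD : x = spin_diag (fun S => coef x S S).
  apply: (spin_diagonal b1) => // i; apply: (comm_occ (D := false)) (covers_gen false i cx) (covers_gen true i cx).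
  by rewrite mulfV.
have dA S : coef x S S = \prod_(i in S) ext a i * coef x set0 set0.
  move: S; apply: (diag_coef (d := fun S => coef x S S)) => i S iS.
  case: (split_ordP i) => j ij.
    by apply: coef_flip => //; rewrite ij (covers_gen false j cx) extendl.
  have := congr1 (fun M => coef M (flip i S) S) (covers_last j cx); rewrite -ij.
  rewrite mulmxDr mulmxDl !coefD !coef_genr !coef_genl in_flip eqxx (negbTE iS) /=.
  rewrite flipK sgn_flip ltnn addr0 addr0 ij extendr mul1r; apply: mulfI.
  by rewrite signr_eq0.
(* The spin form pairs [e_S] with the complementary subset. *)
have d0 : coef x set0 set0 ^+ 2 * \prod_i a i = 1.
  have := congr1 (fun M => coef M set0 setT) (spin_preserves_form sx).
  rewrite {1 2}xD.
  have -> : (spin_diag (fun S => coef x S S))^T = spin_diag (fun S => coef x S S).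
    by apply: coefP => R C; rewrite coef_tr !coef_of_coef eq_sym; case: eqP => [->|].
  rewrite coef_diagr coef_diagl mulrAC -[X in _ = X]mul1r.
  have nzB : coef (spin_form K (n + b)) set0 setT != 0.
    by rewrite coef_of_coef setCT eqxx; apply/prodf_neq0 => i _; rewrite signr_eq0.
  move/(mulIf nzB); rewrite [coef x setT setT]dA => dT; apply: etrans dT.
  rewrite -(ext_prod b) expr2 -mulrA; congr (_ * _); rewrite mulrC; congr (_ * _).
  by apply: eq_bigl => i; rewrite inE.
have [c0 c0a] : exists c0 : 'I_n -> K, forall i, c0 i ^+ 2 = a i.
  exact: (fin_all_exists (fun i => closed_sqrt (a i))).
(* [x] is the lift attached to [c0] up to the sign [e], which is absorbed in
   one of the square roots. *)
pose e := \prod_i c0 i * coef x set0 set0.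
have e2 : e ^+ 2 = 1.
  rewrite exprMn -prodrXl (eq_bigr a) => [|i _]; last exact: c0a.
  by rewrite mulrC.
pose c i := (if i == Ordinal n0 then e else 1) * c0 i.
have ca i : c i ^+ 2 = a i.
  by rewrite exprMn c0a; case: ifP => _; rewrite ?e2 ?expr1n mul1r.
have nzc i : c i != 0 by move: (nza i); rewrite -ca expf_eq0.
have pc : coef x set0 set0 = (\prod_i c i)^-1.
  apply: (@mulfI _ (\prod_i c i)); first by apply/prodf_neq0.
  rewrite mulfV; last by apply/prodf_neq0.
  rewrite big_split /= -big_mkcond big_pred1_eq -mulrA -/e -e2; exact: expr2.
exists c; split=> //; rewrite [LHS]xD; apply: eq_spin_diag => S.
rewrite dA weightE; last exact: extend_neq0.
rewrite ext_prod pc; congr (_ * _); apply: eq_bigr => i _.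
by rewrite /extend; case: split => j; rewrite ?ca ?expr1n.
Qed.

(** The square of a lift does not see the choice of the signs of the square
    roots; this is how fixed points of Frobenius are obtained in the spin
    group. *)
Corollary torus_lift_sqr x a : spin x -> (forall i, a i != 0) ->
    spin_covers x (diag_entries b a) -> x *m x = torus_elt (ext a).
Proof.
move=> sx nza /(torus_lift sx nza)[c [nzc ca ->]]; rewrite torus_eltM.
by apply: eq_torus_elt => i; rewrite /extend; case: split => j; rewrite ?mulr1 -?ca.
Qed.

End TorusLift.

(** * Centralisers of regular elements in spin groups *)

Section SpinCentraliser.
Variables (K : fieldType) (n b : nat).
Hypothesis b1 : (b <= 1)%N.
Implicit Types (x y : 'M[K]_(spin_dim (n + b))) (R C S : {set 'I_(n + b)}).
Implicit Types (a c s : 'I_n -> K).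

Local Notation gen := (@gen K (n + b)).
Local Notation ext := (@extend K n b).

Lemma torus_eltV c : (forall i, c i != 0) ->
  torus_elt (ext c) *m torus_elt (fun i => (ext c i)^-1) = 1%:M.
Proof.
move=> nzc; rewrite torus_eltM -torus_elt1; apply: eq_torus_elt => i.
by rewrite mulfV // extend_neq0.
Qed.

Lemma gen_neq0 d i : gen d i != 0.
Proof.
pose C : {set 'I_(n + b)} := [set j | d].
apply/eqP=> /(congr1 (fun M => coef M (flip i C) C)); rewrite coef_gen coef0.
by rewrite !eqxx inE eqxx => /eqP; rewrite signr_eq0.
Qed.

Lemma cvec_single (f g : 'I_(n + b) -> K) i :
    (forall j, j != i -> f j = 0) -> (forall j, j != i -> g j = 0) ->
  cvec f g = f i *: gen false i + g i *: gen true i.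
Proof.
move=> f0 g0; rewrite /cvec (bigD1 i) //= big1 ?addr0 // => j ji.
by rewrite f0 // g0 // !scale0r addr0.
Qed.

Section Commuting.
Variables (s : 'I_n -> K) (x : 'M[K]_(spin_dim (n + b))).
Hypotheses (nzs : forall i, s i != 0) (sx : spin x).
Hypothesis comm : x *m torus_elt (ext s) = torus_elt (ext s) *m x.

Local Notation A := (fun i => ext s i ^+ 2).
(** [A] lists the entries of the orthogonal matrix below [torus_elt (ext s)], with
    a last entry 1 when [b = 1].  So the condition contains the one for the short
    roots of type [B]. *)
Hypothesis regA : forall i j, i != j -> A i != A j /\ A i * A j != 1.

Let nzA i : A i != 0.
Proof. by rewrite expf_neq0 ?extend_neq0. Qed.

(** An element of the centraliser preserves the eigenspaces of the regular
    element on the orthogonal space. *)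
Lemma eigen_image u (r : K) :
    torus_elt (ext s) *m clifford u = r *: (clifford u *m torus_elt (ext s)) ->
  exists u', [/\ x *m clifford u = clifford u' *m x,
    forall j, A j * xcoord u' j = r * xcoord u' j
    & forall j, (A j)^-1 * ycoord u' j = r * ycoord u' j].
Proof.
move=> tu; have [u' xu] := spin_normal u sx; exists u'.
have ux := spin_unit sx.
have E : torus_elt (ext s) *m clifford u' = r *: (clifford u' *m torus_elt (ext s)).
  apply: (can_inj (mulmxK ux)); rewrite -mulmxA -xu mulmxA -comm -mulmxA tu.
  by rewrite -scalemxAr mulmxA xu -mulmxA comm mulmxA scalemxAl.
have : cvec (fun i => A i * xcoord u' i) (fun i => (A i)^-1 * ycoord u' i) =
       cvec (fun i => r * xcoord u' i) (fun i => r * ycoord u' i).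
  move: E; rewrite cliffordE torus_normal; last exact: extend_neq0.
  rewrite scalemxAl cvecZ => /(congr1 (fun M => M *m torus_elt (fun i => (ext s i)^-1))).
  by rewrite -!mulmxA torus_eltV // !mulmx1.
by case/cvec_inj.
Qed.

(** The eigenvalue of [e_i] or [f_i] occurs at no other hyperbolic pair, so the
    image is an isotropic vector of the plane they span, hence proportional to
    one of them. *)
Lemma gen_image d i : exists d' r, [/\ r != 0,
    x *m gen d (lshift b i) = r *: (gen d' (lshift b i) *m x)
  & d' != d -> A (lshift b i) ^+ 2 = 1].
Proof.
set l := lshift b i.
pose f e := fun j : 'I_(n + b) => ((j == l) && e)%:R : K.
pose u := vec_of (f (~~ d)) (f d).
have uE : clifford u = gen d l.
  by rewrite clifford_vec ?cvec_delta_gen // => j; rewrite /f eq_rlshift.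
pose th := if d then (A l)^-1 else A l.
have tu : torus_elt (ext s) *m clifford u = th *: (clifford u *m torus_elt (ext s)).
  rewrite uE cvec_delta_gen torus_normal; last exact: extend_neq0.
  rewrite scalemxAl cvecZ; congr (_ *m _); apply: eq_cvec => j;
  by case: (j =P l) => [->|_]; rewrite ?mulr0 // /th; case: (d); rewrite ?mulr0.
have [u' [xu xu' yu']] := eigen_image tu.
have off j : j != l -> xcoord u' j = 0 /\ ycoord u' j = 0.
  move=> jl; have [neq ninv] := regA jl.
  have nlj : A l * A j != 1 by rewrite mulrC.
  have n1 : A j != th.
    rewrite /th; case: (d) => //; apply: contra_neq ninv => ->.
    by rewrite mulVf.
  have n2 : (A j)^-1 != th.
    rewrite /th; case: (d); first by rewrite (inj_eq invr_inj).
    by apply: contra_neq nlj => <-; rewrite mulVf.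
  split; apply/eqP; [have /eqP := xu' j | have /eqP := yu' j];
  by rewrite -subr_eq0 -mulrBl mulf_eq0 subr_eq0 ?(negbTE n1) ?(negbTE n2).
have u'E : clifford u' = xcoord u' l *: gen false l + ycoord u' l *: gen true l.
  by rewrite cliffordE; apply: cvec_single => j /off[].
have xy0 : xcoord u' l * ycoord u' l = 0.
  have : clifford u' *m clifford u' = 0.
    apply: (can_inj (mulmxK (spin_unit sx))).
    by rewrite -mulmxA -xu mulmxA -xu -mulmxA uE gen_sqr mulmx0 mul0mx.
  rewrite clifford_sqr qformE (bigD1 l) //= big1 ?addr0 => [|j /off[-> _]]; last by rewrite mul0r.
  move/(congr1 (fun M => coef M set0 set0)); rewrite coef_scalar eqxx coef0.
  exact.
have nz : clifford u' != 0.
  apply/eqP=> u0; have /eqP := gen_neq0 d l; apply.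
  by apply: (can_inj (mulKmx (spin_unit sx))); rewrite -uE xu u0 mul0mx mulmx0.
have sqA : (A l)^-1 = A l -> A l ^+ 2 = 1 by move=> E; rewrite expr2 -{1}E mulVf.
have [x0|xn0] := eqVneq (xcoord u' l) 0.
  exists true, (ycoord u' l); split.
  - by apply: contra_neq nz => y0; rewrite u'E x0 y0 !scale0r addr0.
  - by rewrite -uE xu u'E x0 scale0r add0r scalemxAl.
  case: (d) @th tu xu' yu' => //= tu xu' yu' _.
  have yn0 : ycoord u' l != 0.
    by apply: contra_neq nz => y0; rewrite u'E x0 y0 !scale0r addr0.
  by apply: sqA; apply: (mulIf yn0); apply: yu'.
exists false, (xcoord u' l); split=> //.
  rewrite -uE xu u'E; move/eqP: xy0; rewrite mulf_eq0 (negbTE xn0) => /eqP ->.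
  by rewrite scale0r addr0 scalemxAl.
case: (d) @th tu xu' yu' => //= tu xu' yu' _.
by apply: sqA; apply: (mulIf xn0); apply/esym; apply: xu'.
Qed.

(** The images of [e_i] and [f_i] cannot be proportional to the same vector,
    since [e_i f_i + f_i e_i = 1]. *)
Lemma pair_image i : exists D r r', [/\ r * r' = 1,
    x *m gen false (lshift b i) = r *: (gen D (lshift b i) *m x),
    x *m gen true (lshift b i) = r' *: (gen (~~ D) (lshift b i) *m x)
  & D -> A (lshift b i) ^+ 2 = 1].
Proof.
have [D [r [nzr xe sqA]]] := gen_image false i.
have [D' [r' [nzr' xf _]]] := gen_image true i.
set l := lshift b i in xe xf sqA *.
have ef : (r * r') *: (gen D l *m gen D' l + gen D' l *m gen D l) = 1%:M.
  apply: (can_inj (mulmxK (spin_unit sx))); rewrite mul1mx; apply/esym.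
  have two d d' t t' : x *m gen d l = t *: (gen d' l *m x) -> forall e e',
      x *m gen e l = t' *: (gen e' l *m x) ->
      x *m (gen d l *m gen e l) = (t * t') *: (gen d' l *m gen e' l *m x).
    move=> xd e e' xe'.
    by rewrite mulmxA xd -scalemxAl -mulmxA xe' -scalemxAr scalerA mulmxA.
  rewrite -{1}[x]mulmx1 -(gen_comp K false l) mulmxDr (two _ _ _ _ xe _ _ xf).
  by rewrite (two _ _ _ _ xf _ _ xe) [r' * r]mulrC -scalerDr -mulmxDl scalemxAl.
have DD' : D' = ~~ D.
  have [//|neq] := eqVneq D' (~~ D).
  have eqD : D' = D by move: neq; case: (D); case: (D').
  move: ef; rewrite eqD gen_sqr addr0 scaler0.
  by move/(congr1 (fun M => coef M set0 set0)); rewrite coef_scalar coef0 eqxx => /eqP;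
    rewrite eq_sym oner_eq0.
subst D'; exists D, r, r'; split=> //; last by move=> De; apply: sqA; rewrite De.
move: ef; rewrite gen_comp => /(congr1 (fun M => coef M set0 set0)).
by rewrite coefZ coef_scalar eqxx mulr1.
Qed.

(** Let [Delta] be the set of coordinates which [x] exchanges, read off a nonzero
    coefficient of [x].  Their entries are square roots of 1 and they are pairwise
    distinct, so there are at most two; their number is even because [x] is; and
    if they are [l] and [m], equality of the weights at the two subsets gives
    [A l * A m = 1], which contradicts the regularity. *)
Lemma regular_no_swap i D r r' : r * r' = 1 ->
    x *m gen false (lshift b i) = r *: (gen D (lshift b i) *m x) ->
    x *m gen true (lshift b i) = r' *: (gen (~~ D) (lshift b i) *m x) ->
  D = false.
Proof.
move=> rr xe xf; apply/negbTE/negP => De.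
have [R [C nz]] : exists R C, coef x R C != 0.
  have := spin_unit sx => ux.
  case: (pickP (fun p => coef x p.1 p.2 != 0)) => [[R C] nz|x0]; first by exists R, C.
  have x00 : x = 0.
    by apply: coefP => R C; have := x0 (R, C); rewrite coef0 => /eqP.
  have /eqP := gen_neq0 false (lshift b i); case.
  by rewrite -[gen _ _](mulKmx ux) x00 mul0mx mulmx0.
have memRC (j : 'I_n) : exists2 D' : bool, (lshift b j \in R) = (lshift b j \in C) (+) D'
    & D' -> A (lshift b j) ^+ 2 = 1.
  have [D' [t [t' [tt xe' xf' sqA]]]] := pair_image j; exists D' => //.
  by rewrite (coef_occ_comm (d := false) (e := D') _ nz) ?addbF //; apply: comm_occ xe' xf'.
pose Delta := [set j | (j \in R) != (j \in C)].
have sqD j : j \in Delta -> A j ^+ 2 = 1.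
  rewrite inE; case: (split_ordP j) => l -> {j}; last by rewrite extendr !expr1n.
  by have [D' -> sqA] := memRC l => neq; apply: sqA; move: neq; case: (_ \in _); case: D'.
have iD : lshift b i \in Delta.
  rewrite inE (coef_occ_comm (d := false) (e := D) _ nz) ?De; first by case: (_ \in _).
  by rewrite -De; apply: comm_occ xe xf.
set l := lshift b i in iD.
have [m mD ml] : exists2 m, m \in Delta & m != l.
  apply/exists_inP; apply: contraNT nz => /exists_inPn H.
  have RC : R = flip l C.
    apply/setP=> j; rewrite in_flip; case: eqP => [->|/eqP jl].
      by move: iD; rewrite inE; do 2!case: (_ \in _).
    by apply/eqP; apply: contraNT jl => jD; have := H j; rewrite inE jD negbK => ->.
  by apply/eqP; apply: spin_even => //; rewrite RC card_flip; case: (odd _).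
have [neq ninv] := regA ml.
have pm j : j \in Delta -> A j = 1 \/ A j = -1.
  by move/sqD/eqP; rewrite sqrf_eq1 => /orP[]/eqP; [left|right].
(* A third coordinate would carry a third square root of 1. *)
have RC : R = flip l (flip m C).
  apply/setP=> j; rewrite !in_flip.
  have [->|jl] := eqVneq j l.
    by rewrite eq_sym (negbTE ml); move: iD; rewrite inE; do 2!case: (_ \in _).
  have [->|jm] := eqVneq j m; first by move: mD; rewrite inE; do 2!case: (_ \in _).
  apply/eqP; apply/negPn; apply/negP=> jD'.
  have jD : j \in Delta by rewrite inE.
  have [nl _] := regA jl; have [nm _] := regA jm.
  by case: (pm _ iD) (pm _ mD) (pm _ jD) neq nl nm => -> [] -> [] ->; rewrite ?eqxx.
have := congr1 (fun M => coef M R C) comm; rewrite coef_diagl coef_diagr mulrC => /(mulIf nz).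
have Ainv j : j \in Delta -> (ext s j) ^- 2 = A j.
  by case/pm => e; rewrite e ?invr1 ?invrN1.
rewrite RC !weight_flip ?extend_neq0 // !(Ainv l) // !(Ainv m) // !if_same -mulrA.
have nzw : weight (ext s) C != 0.
  by apply/prodf_neq0 => j _; case: ifP => _; rewrite ?invr_eq0 extend_neq0.
by rewrite -{1}[weight _ _]mulr1 => /(mulfI nzw) /esym/eqP; rewrite (negbTE ninv).
Qed.

(** Once nothing is exchanged, [x] is diagonal in the spin module and acts on the
    first [n] pairs by scalars.  It fixes the vector [e + f] of a last pair, and
    does not change its sign, because it commutes with [volume]. *)
Lemma centraliser_covers :
  exists2 a, forall i, a i != 0 & spin_covers x (diag_entries b a).
Proof.
have ux := spin_unit sx.
have pairs (i : 'I_n) : exists r, r != 0 /\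
    (x *m gen false (lshift b i) = r *: (gen false (lshift b i) *m x) /\
     x *m gen true (lshift b i) = r^-1 *: (gen true (lshift b i) *m x)).
  have [D [r [r' [rr xe xf _]]]] := pair_image i.
  have D0 := regular_no_swap rr xe xf; exists r; rewrite D0 in xe xf.
  have nzr : r != 0 by apply: contra_eq_neq rr => ->; rewrite mul0r eq_sym oner_eq0.
  by split=> //; split=> //; rewrite xf -[r'](mulKf nzr) rr mulr1.
have [a aP] := fin_all_exists pairs.
have nza i : a i != 0 by case: (aP i).
exists a => //.
have xD : x = spin_diag (fun S => coef x S S).
  apply: spin_diagonal => // i; have [_ [xe xf]] := aP i.
  by apply: comm_occ xe xf; rewrite mulfV.
have xw (j : 'I_b) (f : K) : x *m (f *: gen false (rshift n j) + f *: gen true (rshift n j)) =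
    (f *: gen false (rshift n j) + f *: gen true (rshift n j)) *m x.
  set l := rshift n j.
  have vol S : coef x (flip l S) (flip l S) = coef x S S.
    have := congr1 (fun M => coef M S (flip l S)) (spin_volume j b1 sx).
    by rewrite coef_volumel coef_volumer flipK.
  rewrite xD; apply: coefP => S T; rewrite coef_diagl coef_diagr mulrC.
  have [->|neq] := eqVneq S (flip l T); first by rewrite vol.
  by rewrite coefD !coefZ !coef_gen (negbTE neq) !andbF ?(mulr0, addr0, mul0r).
move=> v; rewrite clifford_diag_entries cliffordE /cvec !big_split_ord /=.
rewrite mulmxDr mulmxDl; congr (_ + _); rewrite mulmx_sumr mulmx_suml;
  apply: eq_bigr => i _.
  have [_ [xe xf]] := aP i; rewrite extendl -/(gen false _) -/(gen true _).
  by rewrite mulmxDr mulmxDl -!scalemxAl -!scalemxAr xe xf !scalerA ![_ * a i]mulrC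
       ![_ * (a i)^-1]mulrC.
rewrite extendr invr1 !mul1r.
have -> : ycoord v (rshift n i) = xcoord v (rshift n i).
  by rewrite /xcoord /ycoord split_rshift.
exact: xw.
Qed.

End Commuting.
End SpinCentraliser.

(** * The torus inside the spin group *)

Section TorusInSpin.
Variables (K : fieldType) (n b : nat).

(** A coroot subgroup: the product of the two vectors of norm 1
    [e_i + f_i] and [r^-1 e_i + r f_i]. *)
Lemma spin_single (i : 'I_n) (r : K) : r != 0 ->
  spin (torus_elt (fun j : 'I_(n + b) => if j == lshift b i then r else 1)).
Proof.
move=> nzr; set l := lshift b i; set c := fun j => _.
pose f (t : K) := fun j : 'I_(n + b) => if j == l then t else 0.
have fr t j : f t (rshift n j) = 0 by rewrite /f eq_rlshift.
have vE t t' : clifford (vec_of (f t) (f t')) = t *: gen K false l + t' *: gen K true l.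
  rewrite clifford_vec => [|j]; last by rewrite !fr.
  rewrite (cvec_single (i := l)); first by rewrite /f eqxx.
  - by move=> j /negbTE; rewrite /f => ->.
  by move=> j /negbTE; rewrite /f => ->.
have qE t t' : t * t' = 1 -> qform (vec_of (f t) (f t')) = 1.
  move=> tt; have := clifford_sqr (vec_of (f t) (f t')); rewrite vE.
  rewrite mulmxDl !mulmxDr -!scalemxAl -!scalemxAr !gen_sqr !scaler0 add0r addr0 !scalerA.
  rewrite [t' * t]mulrC tt !scale1r (gen_comp K false l).
  by move/(congr1 (fun M => coef M set0 set0)); rewrite !coef_scalar eqxx.
suff -> : torus_elt c = clifford (vec_of (f 1) (f 1)) *m clifford (vec_of (f r^-1) (f r)).
  by apply: spin_clifford2; apply: qE; rewrite ?mulVf ?mul1r.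
rewrite !vE mulmxDl !mulmxDr -!scalemxAl -!scalemxAr !gen_sqr !scaler0 add0r addr0 !scale1r.
apply: coefP => R C; rewrite coefD !coefZ.
rewrite (coef_occupied K false) (coef_occupied K true) coef_of_coef.
have [->|_] := eqVneq R C; last by rewrite !andbF !mulr0 addr0.
rewrite !andbT mulr1n /weight (bigD1 l) //= big1 ?mulr1 => [|j /negbTE jl]; last first.
  by rewrite /c jl invr1 if_same.
by rewrite /c eqxx; case: (l \in C); rewrite /= ?mulr1 ?mulr0 ?addr0 ?add0r.
Qed.

Lemma torus_spin (c : 'I_n -> K) : (forall i, c i != 0) ->
  spin (torus_elt (extend (b := b) c)).
Proof.
move=> nzc.
have : spin (torus_elt (fun j : 'I_(n + b) =>
    \prod_(i <- enum 'I_n) if j == lshift b i then c i else 1)).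
  elim: (enum _) => [|i r IH].
    rewrite (eq_torus_elt (d := fun=> 1)) ?torus_elt1; first exact: spin1.
    by move=> j; rewrite big_nil.
  have := spinM (spin_single i (nzc i)) IH; rewrite torus_eltM.
  by rewrite (eq_torus_elt (d := fun j => \prod_(i <- i :: r) if j == lshift b i then c i else 1)) // => j;
    rewrite big_cons.
rewrite (eq_torus_elt (d := extend (b := b) c)) // => j; rewrite big_enum /=.
case: (split_ordP j) => i ->.
  rewrite extendl (bigD1 i) //= eqxx big1 ?mulr1 // => k ki.
  by rewrite (inj_eq (@lshift_inj _ _)) eq_sym (negbTE ki).
by rewrite extendr big1 // => k _; rewrite eq_rlshift.
Qed.

End TorusInSpin.

(** * Connectedness of tori *)

Section RationalCurves.
Variables (K : closedFieldType) (Q : {poly K}).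
Implicit Types f g : K -> K.

(** Regular functions on the open subset of the affine line where [Q] does not
    vanish. *)
Definition regular_off f :=
  exists (P : {poly K}) e, forall z, Q.[z] != 0 -> f z = P.[z] / Q.[z] ^+ e.

Lemma eq_regular_off f g :
  (forall z, Q.[z] != 0 -> f z = g z) -> regular_off f -> regular_off g.
Proof. by move=> fg [P [e fP]]; exists P, e => z Qz; rewrite -fg ?fP. Qed.

Lemma regular_off_poly (P : {poly K}) : regular_off (fun z => P.[z]).
Proof. by exists P, 0%N => z _; rewrite expr0 divr1. Qed.

Lemma regular_off_cst a : regular_off (fun=> a).
Proof. by apply: eq_regular_off (regular_off_poly a%:P) => z _; rewrite hornerC. Qed.

Lemma regular_offD f g : regular_off f -> regular_off g ->
  regular_off (fun z => f z + g z).
Proof.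
move=> [P [d fP]] [R [e gR]]; exists (P * Q ^+ e + R * Q ^+ d), (d + e)%N => z Qz.
by rewrite fP // gR // hornerD !hornerM !horner_exp exprD addf_div ?expf_neq0.
Qed.

Lemma regular_offM f g : regular_off f -> regular_off g ->
  regular_off (fun z => f z * g z).
Proof.
move=> [P [d fP]] [R [e gR]]; exists (P * R), (d + e)%N => z Qz.
by rewrite fP // gR // hornerM exprD mulf_div.
Qed.

Lemma regular_off_sum I (r : seq I) (F : I -> K -> K) :
  (forall i, regular_off (F i)) -> regular_off (fun z => \sum_(i <- r) F i z).
Proof.
move=> regF; elim: r => [|i r IH].
  by apply: eq_regular_off (regular_off_cst 0) => z _; rewrite big_nil.
by apply: eq_regular_off (regular_offD (regF i) IH) => z _; rewrite big_cons.
Qed.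

Lemma regular_off_prod I (r : seq I) (F : I -> K -> K) :
  (forall i, regular_off (F i)) -> regular_off (fun z => \prod_(i <- r) F i z).
Proof.
move=> regF; elim: r => [|i r IH].
  by apply: eq_regular_off (regular_off_cst 1) => z _; rewrite big_nil.
by apply: eq_regular_off (regular_offM (regF i) IH) => z _; rewrite big_cons.
Qed.

Lemma regular_off_meval m (p : {mpoly K[m]}) (F : K -> 'I_m -> K) :
  (forall i, regular_off (F^~ i)) -> regular_off (fun z => p.@[F z]).
Proof.
move=> regF; apply: (@eq_regular_off (fun z =>
  \sum_(u <- msupp p) p@_u * \prod_i \prod_(j < u i) F z i)) => [z _|].
  rewrite mevalE; apply: eq_bigr => u _; congr (_ * _); apply: eq_bigr => i _.
  by rewrite prodr_const card_ord.
apply: regular_off_sum => u; apply: regular_offM; first exact: regular_off_cst.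
by apply: regular_off_prod => i; apply: regular_off_prod => j.
Qed.

Definition regular_mx_off m p (M : K -> 'M[K]_(m, p)) :=
  forall i j, regular_off (fun z => M z i j).

Lemma regular_mx_offM m p r (M : K -> 'M[K]_(m, p)) (N : K -> 'M[K]_(p, r)) :
  regular_mx_off M -> regular_mx_off N -> regular_mx_off (fun z => M z *m N z).
Proof.
move=> regM regN i j.
apply: (@eq_regular_off (fun z => \sum_k M z i k * N z k j)) => [z _|].
  by rewrite mxE.
by apply: regular_off_sum => k; apply: regular_offM.
Qed.

Lemma regular_mx_off_cst m p (M : 'M[K]_(m, p)) : regular_mx_off (fun=> M).
Proof. by move=> i j; apply: regular_off_cst. Qed.

Section Connected.
Variables (N : nat) (M : K -> 'M[K]_N).
Hypothesis regM : regular_mx_off M.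

(** A polynomial equation on the ambient space becomes, after multiplication by a
    power of [Q], a polynomial equation on the parameter. *)
Lemma closed_trace_on_curve Z : zariski_closed Z ->
    ~ (forall x, (exists2 z, Q.[z] != 0 & x = M z) -> Z x) ->
  exists2 P : {poly K}, P != 0 & forall z, Q.[z] != 0 -> Z (M z) -> P.[z] = 0.
Proof.
move=> [E ZE] notall; apply: NNPP => noP; apply: notall => _ [z Qz ->].
rewrite ZE => p Ep; apply/eqP; apply: contra_notT noP => nz.
have [P [e pP]] : regular_off (fun z => p.@[fun i => mxvec (M z) 0 i]).
  apply: regular_off_meval => i; case/mxvec_indexP: i => i j.
  by apply: eq_regular_off (regM i j) => y _; rewrite mxvecE.
exists P => [|y Qy].
  by apply: contra_neq nz => P0; rewrite pP // P0 horner0 mul0r.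
rewrite ZE => /(_ p Ep); rewrite pP // => /eqP.
by rewrite mulf_eq0 invr_eq0 expf_eq0 (negbTE Qy) andbF orbF => /eqP.
Qed.

(** Rational curves are irreducible: a polynomial vanishing at all but finitely
    many of its parameters is zero. *)
Lemma rational_curve_connected :
  Q != 0 -> zariski_connected (fun x => exists2 z, Q.[z] != 0 & x = M z).
Proof.
move=> nzQ Z1 Z2 cZ1 cZ2 cover _; apply: NNPP => /not_or_and[n1 n2].
have [P1 nzP1 vanish1] := closed_trace_on_curve cZ1 n1.
have [P2 nzP2 vanish2] := closed_trace_on_curve cZ2 n2.
have /closed_nonrootP[z] : Q * P1 * P2 != 0 by rewrite !mulf_neq0.
rewrite !rootM !negb_or => /andP[/andP[Qz P1z] P2z].
have [|/(vanish1 _ Qz)/eqP|/(vanish2 _ Qz)/eqP] := cover (M z); first by exists z.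
- by apply/negP.
- by apply/negP.
Qed.

End Connected.
End RationalCurves.

(** A torus given by a parametrisation whose entries are Laurent polynomials is
    connected: each of its points is joined to 1 by a line of parameters [1 + z (c i - 1)].  The set of the [z]
    for which none of these vanishes is open and contains 0 and 1. *)
Lemma torus_identity_component (K : closedFieldType) (n N : nat)
    (S : 'M[K]_N -> Prop) (tau : ('I_n -> K) -> 'M[K]_N) :
    (forall c c', c =1 c' -> tau c = tau c') ->
    (forall c, (forall i, c i != 0) -> S (tau c)) ->
    tau (fun=> 1) = 1%:M ->
    (forall (Q : {poly K}) (c : K -> 'I_n -> K),
      (forall i, regular_off Q (c^~ i)) ->
      (forall i, regular_off Q (fun z => (c z i)^-1)) ->
      regular_mx_off Q (fun z => tau (c z))) ->
  forall c, (forall i, c i != 0) -> identity_component S (tau c).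
Proof.
move=> ext_tau S_tau tau1 reg_tau c nzc.
pose l i : {poly K} := 1 + (c i - 1)%:P * 'X.
have lE i z : (l i).[z] = 1 + (c i - 1) * z by rewrite /l !hornerE.
pose Q := \prod_i l i.
have QE z : Q.[z] = \prod_i (l i).[z] by rewrite horner_prod.
have Q0 : Q.[0] != 0.
  by rewrite QE; apply/prodf_neq0 => i _; rewrite lE mulr0 addr0 oner_neq0.
have Q1 : Q.[1] != 0.
  by rewrite QE; apply/prodf_neq0 => i _; rewrite lE mulr1 addrCA subrr addr0.
have regl i : regular_off Q (fun z => (l i).[z]) by apply: regular_off_poly.
have regl' i : regular_off Q (fun z => ((l i).[z])^-1).
  exists (\prod_(j | j != i) l j), 1%N => z; rewrite expr1 QE => nz.
  have := nz; rewrite (bigD1 i) //= mulf_eq0 negb_or => /andP[nzi nzr].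
  by rewrite horner_prod invfM mulrCA mulfV // mulr1.
exists (fun x => exists2 z, Q.[z] != 0 & x = tau (fun i => (l i).[z])); split.
- apply: rational_curve_connected; first by apply: reg_tau.
  by apply: contraNneq Q0 => ->; rewrite horner0.
- move=> _ [z Qz ->]; apply: S_tau => i; apply: contraNneq Qz => lz.
  by rewrite QE (bigD1 i) //= lz mul0r.
- by exists 0 => //; rewrite -tau1; apply: ext_tau => i; rewrite lE mulr0 addr0.
by exists 1 => //; apply: ext_tau => i; rewrite lE mulr1 addrCA subrr addr0.
Qed.


(** * Cycles of signed permutations *)

Section SignedPermutations.
Variables (n : nat) (w : {perm 'I_n * bool}).
Hypothesis ws : signed_perm w.
Implicit Types x y p : 'I_n * bool.
Local Notation inv := (@entry_inv n).

Lemma entry_invK : involutive inv.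
Proof. by case=> i d; rewrite /entry_inv /= negbK. Qed.

Lemma entry_inv_neq p : inv p != p.
Proof. by case: p => i d; rewrite xpair_eqE eqxx /=; case: d. Qed.

Lemma same_index p p' : p.1 = p'.1 -> p' = p \/ p' = inv p.
Proof.
by case: p p' => i d [j d'] /= <-; rewrite /entry_inv /=; case: d d' => [] []; [left|right|right|left].
Qed.

Lemma iter_inv k p : iter k w (inv p) = inv (iter k w p).
Proof. by elim: k => //= k ->; apply: ws. Qed.

Lemma iter_period j p : iter (j * #|porbit w p|) w p = p.
Proof. by elim: j => // j IH; rewrite mulSn iterD IH iter_porbit. Qed.

Lemma porbit_gt0 p : (0 < #|porbit w p|)%N.
Proof. by apply/card_gt0P; exists p; apply: porbit_id. Qed.

Lemma iter_modn j p : iter (j %% #|porbit w p|) w p = iter j w p.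
Proof. by rewrite [in RHS](divn_eq j #|porbit w p|) addnC iterD iter_period. Qed.

Lemma iter_eq j k p : iter j w p = iter k w p -> j = k %[mod #|porbit w p|].
Proof.
rewrite -iter_modn -[RHS]iter_modn => E.
have lt i : (i %% #|porbit w p| < #|porbit w p|)%N by rewrite ltn_mod porbit_gt0.
have := uniq_traject_porbit w p => /(nth_uniq p).
rewrite size_traject => /(_ _ _ (lt j) (lt k)).
by rewrite !nth_traject // E eqxx => /esym/eqP.
Qed.

Lemma iter_in_porbit k p : iter k w p \in porbit w p.
Proof. by apply/porbitP; exists k; rewrite permX. Qed.

Lemma porbit_iter p p' : p' \in porbit w p -> exists k, p' = iter k w p.
Proof. by case/porbitP=> k ->; exists k; rewrite permX. Qed.

Lemma porbit_eq x p : x \in porbit w p -> porbit w x = porbit w p.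
Proof. by rewrite -eq_porbit_mem => /eqP. Qed.

Definition self_inverse p := inv p \in porbit w p.

Lemma self_inverse_cycleE p : self_inverse_cycle (porbit w p) = self_inverse p.
Proof.
apply/exists_inP/idP => [[x]|ip]; last by exists p; rewrite ?porbit_id.
case/porbit_iter=> k ->; rewrite -iter_inv => ixp.
have : inv p \in porbit w (iter k w (inv p)) by rewrite porbit_sym iter_in_porbit.
by rewrite (porbit_eq ixp).
Qed.

(** Number of indices [i] met by the cycle through [p], so that this is the
    corresponding part of one of the two partitions. *)
Definition cycle_length p :=
  if self_inverse p then #|porbit w p|./2 else #|porbit w p|.

Lemma iter_half p : self_inverse p ->
  (#|porbit w p| = 2 * cycle_length p)%N /\ iter (cycle_length p) w p = inv p.
Proof.
move=> ip; rewrite /cycle_length ip; have [k ek] := porbit_iter ip.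
set m := #|porbit w p|; have m0 : (0 < m)%N := porbit_gt0 p.
pose j := (k %% m)%N; have ej : iter j w p = inv p by rewrite iter_modn -ek.
have lt_jm : (j < m)%N by rewrite ltn_mod.
have j0 : (0 < j)%N.
  by rewrite lt0n; apply: contraNneq (entry_inv_neq p) => j0; rewrite -ej j0.
have : iter (j + j) w p = iter 0 w p by rewrite iterD ej iter_inv ej entry_invK.
move/iter_eq; rewrite -/m mod0n => /eqP /dvdnP[c jj].
have -> : m = (2 * j)%N.
  have c1 : c = 1%N by clear -jj lt_jm j0; clearbody j m; nia.
  by move: jj; rewrite c1 mul1n mul2n addnn.
by rewrite !mul2n doubleK.
Qed.

Lemma cycle_length_gt0 p : (0 < cycle_length p)%N.
Proof.
have := porbit_gt0 p; rewrite /cycle_length; case: ifP => // ip.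
by case: (iter_half ip) => ->; rewrite /cycle_length ip mul2n double_gt0 doubleK.
Qed.

Lemma cycle_length_index k p : (cycle_length p %| k)%N -> (iter k w p).1 = p.1.
Proof.
case/dvdnP=> c ->{k}; have [ip|nip] := boolP (self_inverse p); last first.
  by rewrite /cycle_length (negbTE nip) iter_period.
have [_ half] := iter_half ip; elim: c => // c IH.
by rewrite mulSn addnC iterD half iter_inv /= IH.
Qed.

(** A cycle together with the opposite one.  The classes correspond to the parts
    of the two partitions. *)
Definition entry_class p := porbit w p :|: porbit w (inv p).

Lemma porbit_inv p x : (inv x \in porbit w p) = (x \in porbit w (inv p)).
Proof.
apply/idP/idP => /porbit_iter[k E].
  by rewrite -[x]entry_invK E -iter_inv iter_in_porbit.
by rewrite E iter_inv entry_invK iter_in_porbit.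
Qed.

Lemma in_class p x : (x \in entry_class p) = (x \in porbit w p) || (inv x \in porbit w p).
Proof. by rewrite inE porbit_inv. Qed.

Lemma class_eq p x : x \in entry_class p -> entry_class x = entry_class p.
Proof.
rewrite in_class /entry_class => /orP[xp|]; last first.
  move=> ip; have /porbit_eq-> : x \in porbit w (inv p) by rewrite -porbit_inv.
  by rewrite (porbit_eq ip) setUC.
by rewrite (porbit_eq xp); congr (_ :|: _); apply: porbit_eq; rewrite -porbit_inv entry_invK.
Qed.

Definition class_repr p := odflt p [pick x in entry_class p].

Lemma class_repr_mem p : p \in entry_class (class_repr p).
Proof.
rewrite /class_repr; case: pickP => [x /class_eq ->|_] /=;
by rewrite in_class porbit_id.
Qed.

Lemma class_repr_eq p x : x \in entry_class p -> class_repr x = class_repr p.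
Proof.
move=> xp; rewrite /class_repr (class_eq xp); case: pickP => // /(_ p).
by rewrite in_class porbit_id.
Qed.

Lemma class_repr_inv p : class_repr (inv p) = class_repr p.
Proof. by apply: class_repr_eq; rewrite in_class entry_invK porbit_id orbT. Qed.

Lemma class_repr_step p : class_repr (w p) = class_repr p.
Proof. by apply: class_repr_eq; rewrite in_class (iter_in_porbit 1). Qed.

Section Orbits.
Variables (K : fieldType) (q : nat).

(** A value at the representative of a class extends to an equivariant function
    provided that it is compatible with the return of the cycle to its starting
    point, or to its inverse; by [iter_eq] and [iter_half] there are no other
    relations. *)
Lemma propagate (z : 'I_n * bool -> K) :
    (forall x, z x != 0) ->
    (forall x, z x ^+ (q ^ cycle_length x) =
               if self_inverse x then (z x)^-1 else z x) ->
  exists s : 'I_n * bool -> K, forall p,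
    [/\ s (w p) = s p ^+ q, s (inv p) = (s p)^-1
      & exists k, iter k w (class_repr p) = p /\ s p = z (class_repr p) ^+ (q ^ k)
               \/ iter k w (class_repr p) = inv p
                  /\ s p = (z (class_repr p) ^+ (q ^ k))^-1].
Proof.
move=> nzz zq.
have zm x : z x ^+ (q ^ #|porbit w x|) = z x.
  have := zq x; case: ifP => [ix|ix]; last by rewrite /cycle_length ix.
  case: (iter_half ix) => -> _ E.
  by rewrite mul2n -addnn expnD exprM E exprVn E invrK.
have zmod x j : z x ^+ (q ^ j) = z x ^+ (q ^ (j %% #|porbit w x|)).
  rewrite [in LHS](divn_eq j #|porbit w x|) expnD exprM; congr (_ ^+ _).
  elim: (j %/ _)%N => [|c IH]; first by rewrite mul0n expr1.
  by rewrite mulSn expnD exprM zm.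
have same x j k : iter j w x = iter k w x -> z x ^+ (q ^ j) = z x ^+ (q ^ k).
  by move/iter_eq => E; rewrite zmod E -zmod.
have opp x j k : iter j w x = inv (iter k w x) -> z x ^+ (q ^ j) = (z x ^+ (q ^ k))^-1.
  move=> E; have ix : self_inverse x.
    rewrite -self_inverse_cycleE; apply/exists_inP.
    by exists (iter k w x); rewrite ?iter_in_porbit // -E iter_in_porbit.
  have [_ half] := iter_half ix.
  have /same-> : iter j w x = iter (cycle_length x + k) w x.
    by rewrite addnC iterD half iter_inv.
  by rewrite expnD exprM zq ix exprVn.
pose good p v := forall k,
  (iter k w (class_repr p) = p -> v = z (class_repr p) ^+ (q ^ k)) /\
  (iter k w (class_repr p) = inv p -> v = (z (class_repr p) ^+ (q ^ k))^-1).
have ex p : exists k, iter k w (class_repr p) = p \/ iter k w (class_repr p) = inv p.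
  have := class_repr_mem p; rewrite in_class => /orP[]/porbit_iter[k ek]; exists k; [left|right]; exact: esym.
have exgood p : exists v, good p v.
  have [k0 [e0|e0]] := ex p.
    exists (z (class_repr p) ^+ (q ^ k0)) => k; split=> e.
      by apply: same; rewrite e e0.
    by apply: opp; rewrite e e0 entry_invK.
  exists (z (class_repr p) ^+ (q ^ k0))^-1 => k; split=> e.
    by rewrite (@opp _ k0 k) ?invrK // e0 e.
  by rewrite (@same _ k0 k) // e0 e.
have [s sP] := fin_all_exists exgood; exists s => p.
have [k ek] := ex p; split.
- case: ek => ek.
    rewrite (proj1 (sP p k) ek) (proj1 (sP (w p) k.+1)) class_repr_step.
      by rewrite expnSr exprM.
    by rewrite /= ek.
  rewrite (proj2 (sP p k) ek) (proj2 (sP (w p) k.+1)) class_repr_step.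
    by rewrite expnSr exprM exprVn.
  by rewrite /= ek ws.
- case: ek => ek.
    rewrite (proj1 (sP p k) ek) (proj2 (sP (inv p) k)) class_repr_inv //.
    by rewrite entry_invK.
  by rewrite (proj2 (sP p k) ek) (proj1 (sP (inv p) k)) class_repr_inv // invrK.
exists k; have [sp1 sp2] := sP p k.
by case: ek => ek; [left|right]; split=> //; [apply: sp1|apply: sp2].
Qed.

End Orbits.
End SignedPermutations.

Section UpToInversion.
Variables (K : fieldType) (q : nat).
Implicit Types u v : K.

(** For the entries of a diagonal matrix, being equal up to inversion is what
    the roots of type [D] detect. *)
Definition eq_up_to_inv u v := v = u \/ v = u^-1.
Local Notation pm := eq_up_to_inv.

Lemma pm_refl u : pm u u. Proof. by left. Qed.

Lemma pm_sym u v : pm u v -> pm v u.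
Proof. by case=> ->; [left | right; rewrite invrK]. Qed.

Lemma pm_trans v u r : pm u v -> pm v r -> pm u r.
Proof. by do 2![case=> ->]; rewrite ?invrK; by [left | right]. Qed.

Lemma pmX m u v : pm u v -> pm (u ^+ m) (v ^+ m).
Proof. by case=> ->; rewrite ?exprVn; by [left | right]. Qed.

Hypothesis frob_inj : injective (fun x : K => x ^+ q).

Lemma expq_inj k : injective (fun x : K => x ^+ (q ^ k)).
Proof.
elim: k => [|k IH] u v; first by rewrite !expr1.
by rewrite /= !expnS !exprM => /IH/frob_inj.
Qed.

Lemma pmX_inj k u v : pm (u ^+ (q ^ k)) (v ^+ (q ^ k)) -> pm u v.
Proof.
by case=> E; [left | right]; apply: (@expq_inj k); rewrite //= exprVn.
Qed.

(** If the orbit of [z x] under [q]-th powers, up to inversion, has the full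
    length of the cycle of [x], then two entries which agree up to inversion lie
    on cycles of the same length; [z_distinct] then says that these cycles form
    the same class, on which [z_minimal] gives the same index. *)

Section Separation.
Variables (n : nat) (w : {perm 'I_n * bool}).
Hypothesis ws : signed_perm w.
Variables z s : 'I_n * bool -> K.
Hypothesis sz : forall p, exists2 k,
  (iter k w (class_repr w p)).1 = p.1 & pm (s p) (z (class_repr w p) ^+ (q ^ k)).
Hypothesis z_period : forall x, pm (z x) (z x ^+ (q ^ cycle_length w x)).
Hypothesis z_minimal :
  forall x k, (0 < k < cycle_length w x)%N -> ~ pm (z x) (z x ^+ (q ^ k)).
Hypothesis z_distinct : forall x x' k, x' \notin entry_class w x ->
  cycle_length w x = cycle_length w x' -> ~ pm (z x) (z x' ^+ (q ^ k)).

Lemma pm_periods x c : pm (z x) (z x ^+ (q ^ (c * cycle_length w x))).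
Proof.
elim: c => [|c IH]; first by rewrite mul0n expr1; apply: pm_refl.
rewrite mulSn expnD exprM; apply: pm_trans IH _; apply: pmX; exact: z_period.
Qed.

Lemma period_dvd x k : pm (z x) (z x ^+ (q ^ k)) -> (cycle_length w x %| k)%N.
Proof.
rewrite [in z x ^+ _](divn_eq k (cycle_length w x)) expnD exprM => zk.
have := pm_trans zk (pm_sym (pmX (q ^ (k %% cycle_length w x)) (pm_periods x _))).
rewrite /dvdn; have [//|r0] := posnP (k %% cycle_length w x).
by move/z_minimal; case; rewrite r0 ltn_mod cycle_length_gt0.
Qed.

Lemma entries_separated p p' : pm (s p) (s p') -> p.1 = p'.1.
Proof.
have [[k <- sp] [k' <- sp']] := (sz p, sz p').
have [xE xE'] : class_repr w (class_repr w p) = class_repr w p /\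
    class_repr w (class_repr w p') = class_repr w p'.
  by split; apply/esym/class_repr_eq => //; apply: class_repr_mem.
move: (class_repr w p) (class_repr w p') xE xE' sp sp' => x x' xE xE' sp sp' ss.
have zz : pm (z x ^+ (q ^ k)) (z x' ^+ (q ^ k')).
  exact: pm_trans (pm_sym sp) (pm_trans ss sp').
have dvd y y' i i' : pm (z y ^+ (q ^ i)) (z y' ^+ (q ^ i')) ->
    (cycle_length w y' %| cycle_length w y)%N.
  move=> yy; apply: period_dvd; apply: (@pmX_inj i').
  apply: pm_trans (pm_sym yy) _; rewrite exprAC.
  apply: pm_trans (pmX _ yy); rewrite exprAC; apply: pmX; exact: z_period.
have [xx'|nxx'] := boolP (x' \in entry_class w x); last first.
  have lenE : cycle_length w x = cycle_length w x'.
    by apply/eqP; rewrite eqn_dvd (dvd _ _ _ _ zz) (dvd _ _ _ _ (pm_sym zz)).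
  case: (z_distinct (k := k' + (k * cycle_length w x - k)) nxx' lenE).
  apply: pm_trans (pm_periods x k) _.
  rewrite expnD exprM; have := pmX (q ^ (k * cycle_length w x - k)) zz.
  by rewrite -[X in pm X]exprM -expnD subnKC // leq_pmulr // cycle_length_gt0.
have {}xx' : x' = x by rewrite -xE -xE'; apply: class_repr_eq.
rewrite {}xx' {sp sp' ss xE xE'} in zz *.
have le_case i i' : (i <= i')%N -> pm (z x ^+ (q ^ i)) (z x ^+ (q ^ i')) ->
    (iter i w x).1 = (iter i' w x).1.
  move=> le_i ii'; have : pm (z x) (z x ^+ (q ^ (i' - i))).
    by apply: (@pmX_inj i); rewrite -[X in pm _ X]exprM -expnD subnK.
  move/period_dvd/(cycle_length_index ws)/esym/same_index => E.
  rewrite -(subnKC le_i) iterD; case: E => -> //.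
  by rewrite iter_inv.
by case/orP: (leq_total k k') => /le_case H; [apply: H | apply/esym/H/pm_sym].
Qed.

End Separation.
End UpToInversion.

(** * The choice of roots of unity *)

Section NumberTheory.

(** The orders that occur are so large that a power of [q] cannot act as
    inversion or trivially before the full length of the cycle.  Mostly this is
    a matter of size; for [q = 2] the quotient of [2 * (q ^ k + 1)] by
    [q ^ l - 1] can lie strictly between 1 and 2.  The exception is [l = 2] with
    [q <= 3]: 3 divides [2 + 1] and 8 divides [2 * (3 + 1)]. *)
Lemma no_early_period_minus q l e k : (1 < q)%N -> ((q <= 3)%N -> l <> 2%N) ->
  (e = 1 \/ e = 2)%N -> (0 < k < l)%N ->
  ~~ (q ^ l - 1 %| e * (q ^ k - 1))%N && ~~ (q ^ l - 1 %| e * (q ^ k + 1))%N.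
Proof.
move=> q1 ql e12 /andP[k0 kl].
suff /andP[n1 n2] : ~~ (q ^ l - 1 %| 2 * (q ^ k - 1))%N && ~~ (q ^ l - 1 %| 2 * (q ^ k + 1))%N.
  by case: e12 => ->; rewrite ?n1 ?n2 // !mul1n; apply/andP; split;
    [apply: contra n1 | apply: contra n2]; apply: dvdn_mull.
(* [a * b] is [q ^ l], and [a * b - 1 <= 2 * (a + 1)] leaves few cases. *)
set b := (q ^ (l - k))%N; set a := (q ^ k)%N.
have -> : (q ^ l = a * b)%N by rewrite -expnD subnKC // ltnW.
have aq : (q <= a)%N by rewrite -{1}[q]expn1 leq_exp2l.
have bq : (q <= b)%N by rewrite -{1}[q]expn1 leq_exp2l // subn_gt0.
apply/andP; split; apply/negP => dv.
  have := dvdn_leq _ dv; have -> : (0 < 2 * (a - 1))%N by lia.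
  by move=> /(_ isT); nia.
have := dvdn_leq _ dv; have -> : (0 < 2 * (a + 1))%N by lia.
move=> /(_ isT) le.
have far x y : (3 <= x)%N -> (4 <= y)%N -> (2 * (x + 1) < x * y - 1)%N by clear; nia.
have far' x y : (4 <= x)%N -> (3 <= y)%N -> (2 * (x + 1) < x * y - 1)%N by clear; nia.
have q3 : (q <= 3)%N.
  rewrite leqNgt; apply/negP => q4; have := far a b; clearbody a b; lia.
have l2 := ql q3.
have [q2|q3'] : q = 2%N \/ q = 3%N by lia.
  have kl1 : (1 < l - k)%N \/ l = k.+1 by lia.
  have a2 : (1 < k)%N -> (4 <= a)%N by move=> k2; rewrite /a q2 -[4%N]/(2 ^ 2)%N leq_exp2l.
  case: kl1 => [lk|lk].
    have b4 : (4 <= b)%N by rewrite /b q2 -[4%N]/(2 ^ 2)%N leq_exp2l.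
    have a3 : (3 <= a)%N \/ a = 2%N by lia.
    clearbody a b; case: a3 => [/far/(_ b4)|a3]; first by lia.
    by rewrite a3 in le; lia.
  have b2 : b = 2%N by rewrite /b q2 lk subSnn.
  have a4 : (4 <= a)%N by apply: a2; lia.
  rewrite b2 in dv; clearbody a b; clear -dv a4.
  by case/dvdnP: dv => -[|[|c]] E; nia.
have [ea eb] : a = 3%N /\ b = 3%N.
  by have := far a b; have := far' a b; clearbody a b; lia.
move: ea eb; rewrite /a /b q3'.
have e3 m : (3 ^ m = 3)%N -> m = 1%N.
  by move=> E; apply/eqP; rewrite -(@eqn_exp2l 3) // E.
by move=> /e3 + /e3; lia.
Qed.

Lemma no_early_period_plus q m e k : (1 < q)%N ->
  (e = 1 \/ e = 2)%N -> (0 < k < m)%N ->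
  ~~ (q ^ m + 1 %| e * (q ^ k - 1))%N && ~~ (q ^ m + 1 %| e * (q ^ k + 1))%N.
Proof.
move=> q1 e12 /andP[k0 km].
suff /andP[n1 n2] : ~~ (q ^ m + 1 %| 2 * (q ^ k - 1))%N && ~~ (q ^ m + 1 %| 2 * (q ^ k + 1))%N.
  by case: e12 => ->; rewrite ?n1 ?n2 // !mul1n; apply/andP; split;
    [apply: contra n1 | apply: contra n2]; apply: dvdn_mull.
set b := (q ^ (m - k))%N; set a := (q ^ k)%N.
have -> : (q ^ m = a * b)%N by rewrite -expnD subnKC // ltnW.
have aq : (q <= a)%N by rewrite -{1}[q]expn1 leq_exp2l.
have bq : (q <= b)%N by rewrite -{1}[q]expn1 leq_exp2l // subn_gt0.
apply/andP; split; apply/negP => dv; have := dvdn_leq _ dv.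
  have -> : (0 < 2 * (a - 1))%N by lia.
  by move=> /(_ isT); nia.
have -> : (0 < 2 * (a + 1))%N by lia.
move=> /(_ isT) le.
have b2 : (b = 2)%N by clearbody a b; clear -aq bq q1 le; nia.
rewrite b2 in dv; clearbody a b; clear -dv aq q1.
by case/dvdnP: dv => -[|[|c]] E; nia.
Qed.

Lemma closed_primitive_root (K : closedFieldType) N : (0 < N)%N -> N%:R != 0 :> K ->
  exists z : K, N.-primitive_root z.
Proof.
move=> N0 nzN.
have [rs Ers] := closed_field_poly_normal ('X^N - 1 : {poly K}).
rewrite (monicP (monicXnsubC _ N0)) scale1r in Ers.
have sz : size rs = N.
  have : size ('X^N - 1 : {poly K}) = N.+1 by apply: size_XnsubC.
  by rewrite Ers size_prod_XsubC => -[].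
have : has N.-primitive_root rs.
  apply: has_prim_root => //; last by rewrite sz.
    apply/allP=> x xrs; rewrite /root_of_unity Ers.
    by rewrite root_prod_XsubC.
  rewrite -separable_prod_XsubC -Ers; exact: separable_Xn_sub_1.
by case/hasP=> z _ prim; exists z.
Qed.

End NumberTheory.

Section CycleType.
Variables (n : nat) (w : {perm 'I_n * bool}) (lam mu : seq nat).
Hypotheses (ws : signed_perm w) (wt : has_cycle_type w lam mu).
Implicit Types x y p : 'I_n * bool.
Local Notation inv := (@entry_inv n).
Local Notation self_inverse := (self_inverse w).
Local Notation cycle_length := (cycle_length w).

Lemma count_image (I J : eqType) (f : I -> J) (s t : seq I) c :
  uniq t -> {subset t <= s} -> all (fun i => f i == c) t ->
  (size t <= count_mem c [seq f i | i <- s])%N.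
Proof.
move=> ut ts ft; rewrite count_map -size_filter; apply: uniq_leq_size => // x xt.
by rewrite mem_filter /= ts // (allP ft).
Qed.

Lemma porbit_in_porbits x : porbit w x \in enum (porbits w).
Proof. by rewrite mem_enum imset_f. Qed.

Lemma count_self_inverse m (t : seq ('I_n * bool)) :
  uniq [seq porbit w x | x <- t] ->
  all (fun x => self_inverse x && (cycle_length x == m)) t -> (size t <= count_mem m mu)%N.
Proof.
move=> ut /allP tm.
have -> : count_mem m mu = count_mem (2 * m)%N [seq (2 * i)%N | i <- mu].
  by rewrite count_map; apply: eq_count => i /=; rewrite eqn_pmul2l.
case: wt => /seq.permP/(_ (pred1 (2 * m)%N)) <- _; rewrite -(size_map (porbit w)).
apply: count_image => // [P /mapP[x xt ->]|].
  rewrite mem_filter self_inverse_cycleE // porbit_in_porbits andbT.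
  by case/andP: (tm _ xt).
apply/allP=> P /mapP[x xt ->]; have /andP[ix /eqP <-] := tm _ xt.
by case: (iter_half ws ix) => ->.
Qed.

Lemma count_not_self_inverse l (t : seq ('I_n * bool)) :
  uniq [seq porbit w x | x <- t] ->
  all (fun x => ~~ self_inverse x && (cycle_length x == l)) t ->
  (size t <= 2 * count_mem l lam)%N.
Proof.
move=> ut /allP tl; rewrite mul2n -addnn -count_cat.
case: wt => _ /seq.permP/(_ (pred1 l)) <-; rewrite -(size_map (porbit w)).
apply: count_image => // [P /mapP[x xt ->]|].
  rewrite mem_filter self_inverse_cycleE // porbit_in_porbits andbT.
  by case/andP: (tl _ xt).
apply/allP=> P /mapP[x xt ->]; have /andP[ix /eqP <-] := tl _ xt.
by rewrite /cycle_length (negbTE ix).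
Qed.

Lemma not_self_inverse_length x : ~~ self_inverse x -> cycle_length x \in lam.
Proof.
move=> ix; rewrite -has_pred1 has_count -(ltn_pmul2l (ltn0Sn 1)) muln0.
by apply: (@count_not_self_inverse _ [:: x]) => //=; rewrite ix eqxx.
Qed.

Lemma porbit_neq x x' : x' \notin entry_class w x -> porbit w x != porbit w x'.
Proof.
rewrite in_class // negb_or => /andP[nx _]; apply: contraNneq nx => ->.
exact: porbit_id.
Qed.

Lemma self_inverse_inv x : self_inverse (inv x) = self_inverse x.
Proof. by rewrite /self_inverse entry_invK porbit_sym. Qed.

Lemma cycle_length_inv x : cycle_length (inv x) = cycle_length x.
Proof.
rewrite /cycle_length self_inverse_inv.
suff -> : porbit w (inv x) = inv @: porbit w x by rewrite card_imset //; apply: inv_inj; exact: entry_invK.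
apply/setP=> y; rewrite -porbit_inv //; apply/idP/imsetP => [iy|[u ux ->]].
  by exists (inv y); rewrite ?entry_invK.
by rewrite entry_invK.
Qed.

(** The list of lengths contains each part of [lam] twice, and the two cycles of
    one class already account for that. *)
Lemma distinct_lengths_minus x x' : uniq lam -> x' \notin entry_class w x ->
  ~~ self_inverse x -> ~~ self_inverse x' -> cycle_length x != cycle_length x'.
Proof.
move=> ul nx ix ix'; apply/eqP=> eqL.
have : (3 <= 2 * count_mem (cycle_length x) lam)%N.
  apply: (@count_not_self_inverse _ [:: x; inv x; x']) => /=.
    rewrite !inE negb_or (porbit_neq nx) !andbT; apply/andP; split.
      by rewrite eq_porbit_mem porbit_sym.
    rewrite in_class // negb_or in nx; case/andP: nx => _; rewrite porbit_inv //.
    by apply: contraNneq => ->; apply: porbit_id.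
  by rewrite self_inverse_inv cycle_length_inv ix ix' -eqL !eqxx.
by rewrite count_uniq_mem //; case: (_ \in _).
Qed.

Lemma distinct_lengths_plus x x' : x' \notin entry_class w x ->
  self_inverse x -> self_inverse x' -> cycle_length x = cycle_length x' ->
  (2 <= count_mem (cycle_length x) mu)%N.
Proof.
move=> nx ix ix' eqL; apply: (@count_self_inverse _ [:: x; x']) => /=.
  by rewrite !inE (porbit_neq nx).
by rewrite ix ix' -eqL !eqxx.
Qed.

Section TorusEntries.
Variables (K : closedFieldType) (q e : nat).
Hypotheses (q1 : (1 < q)%N) (qK : q%:R = 0 :> K) (e12 : (e = 1 \/ e = 2)%N).
Hypothesis frob_inj : injective (fun x : K => x ^+ q).
Hypothesis lam2 : forall l, l \in lam -> (q <= 3)%N -> l <> 2%N.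

Local Notation pm := (@eq_up_to_inv K).

(** Going once around the cycle multiplies the exponent by [q ^ l], which has to
    be the identity, or by [q ^ m], which has to be inversion. *)
Definition seed_order x : nat :=
  (if self_inverse x then q ^ cycle_length x + 1 else q ^ cycle_length x - 1)%N.

Lemma seed_order_gt0 x : (0 < seed_order x)%N.
Proof.
rewrite /seed_order; case: ifP => _; first by rewrite addn1.
by rewrite subn_gt0 -{1}(expn0 q) ltn_exp2l // cycle_length_gt0.
Qed.

Lemma seed_order_neq0 x : (seed_order x)%:R != 0 :> K.
Proof.
have qL : (q ^ cycle_length x)%:R = 0 :> K.
  by rewrite natrX qK expr0n eqn0Ngt cycle_length_gt0.
rewrite /seed_order; case: ifP => _; first by rewrite natrD qL add0r oner_neq0.
by rewrite natrB ?expn_gt0 ?(ltnW q1) // qL sub0r oppr_eq0 oner_neq0.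
Qed.

Lemma primitive_root_neq0 N (z : K) : N.-primitive_root z -> z != 0.
Proof. by move=> zN; rewrite (prim_root_eq0 zN) -lt0n (prim_order_gt0 zN). Qed.

Lemma prim_pm N (z : K) k : N.-primitive_root z -> pm (z ^+ e) (z ^+ e ^+ (q ^ k)) ->
  (N %| e * (q ^ k - 1))%N || (N %| e * (q ^ k + 1))%N.
Proof.
move=> zN; have q0 : (0 < q ^ k)%N by rewrite expn_gt0 ltnW.
have nz : z ^+ e != 0 by rewrite expf_neq0 ?(primitive_root_neq0 zN).
rewrite !(prim_order_dvd zN) !exprM; case=> E; apply/orP; [left|right].
  by apply/eqP; apply: (mulIf nz); rewrite mul1r -exprSr subn1 prednK.
by rewrite addn1 exprSr E mulVf.
Qed.

(** [E] is empty, unless two classes have the same length 1 and the same type; it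
    is then one of the two, and the value 1 on it tells them apart. *)

Section Seeds.
Variable E : {set 'I_n * bool}.
Hypothesis E_short : forall x, x \in E -> self_inverse x && (cycle_length x == 1%N).
Hypothesis E_single : forall x x', x \in E -> x' \in E -> x' \in entry_class w x.
Hypothesis E_lam : forall x x', x \in E -> cycle_length x' = 1%N -> self_inverse x'.
Hypothesis lengths : forall x x', x \notin E -> x' \notin E -> x' \notin entry_class w x ->
  self_inverse x = self_inverse x' -> cycle_length x != cycle_length x'.

Variable z : 'I_n * bool -> K.
Hypothesis zE : forall x, x \in E -> z x = 1.
Hypothesis z_prim : forall x, x \notin E -> (seed_order x).-primitive_root (z x).

Lemma seed_neq0 x : z x != 0.
Proof.
have [/zE->|/z_prim zx] := boolP (x \in E); first exact: oner_neq0.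
exact: primitive_root_neq0 zx.
Qed.

Lemma seed_period x : z x ^+ (q ^ cycle_length x) = if self_inverse x then (z x)^-1 else z x.
Proof.
have [/zE->|/z_prim/prim_expr_order] := boolP (x \in E).
  by rewrite expr1n invr1 if_same.
rewrite /seed_order; case: ifP => _ E1.
  by apply: (mulIf (seed_neq0 x)); rewrite mulVf ?seed_neq0 // -exprSr -addn1.
have q0 : (0 < q ^ cycle_length x)%N by rewrite expn_gt0 ltnW.
by rewrite -(subnK q0) exprD E1 mul1r expr1.
Qed.

Lemma seed_pm_period x : pm (z x) (z x ^+ (q ^ cycle_length x)).
Proof. by rewrite seed_period; case: ifP => _; [right | left]. Qed.

Lemma seed_minimal x k : (0 < k < cycle_length x)%N ->
  ~ pm (z x ^+ e) (z x ^+ e ^+ (q ^ k)).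
Proof.
move=> kx; have nE : x \notin E.
  by apply: contraTN kx => /E_short/andP[_ /eqP->]; case: k => [|[]].
move/(prim_pm (z_prim nE)); apply/negP; rewrite negb_or /seed_order.
have [ix|ix] := boolP (self_inverse x); first exact: no_early_period_plus.
by apply: no_early_period_minus => // q3; apply: lam2 q3; apply: not_self_inverse_length.
Qed.

Lemma dvd_small m : (m %| e)%N -> (m <= 2)%N.
Proof. by move/dvdn_leq; case: e12 => -> /(_ isT) //; lia. Qed.

(** Two classes of the same length outside [E] have different types.  If the
    values met, they would be square roots of 1, which leaves only [q ^ L = 3] and
    [e = 2]; then the value of one is 1 and that of the other is -1. *)
Lemma seed_distinct x x' k : x' \notin entry_class w x ->
  cycle_length x = cycle_length x' -> ~ pm (z x ^+ e) (z x' ^+ e ^+ (q ^ k)).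
Proof.
move=> nx eqL.
have one y : y \notin E -> self_inverse y -> z y ^+ e != 1.
  move=> yE iy; rewrite -(prim_order_dvd (z_prim yE)); apply: contraTN isT => /dvd_small.
  rewrite /seed_order iy; have : (q ^ 1 <= q ^ cycle_length y)%N.
    by rewrite leq_exp2l // cycle_length_gt0.
  by rewrite expn1; lia.
have expq1 (u : K) i : u ^+ (q ^ i) = 1 -> u = 1.
  by move=> u1; apply: (expq_inj frob_inj (k := i)); rewrite u1 expr1n.
have [xE|xE] := boolP (x \in E).
  have x'E : x' \notin E by apply: contra nx => /(E_single xE).
  have /andP[_ /eqP Lx] := E_short xE.
  have /(one _ x'E) neq1 : self_inverse x' by apply: (E_lam xE); rewrite -eqL.
  rewrite (zE xE) expr1n /eq_up_to_inv invr1 => -[] /expq1 E1; by rewrite E1 eqxx in neq1.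
have [x'E|x'E] := boolP (x' \in E).
  have /andP[_ /eqP Lx] := E_short x'E.
  have /(one _ xE) : self_inverse x by apply: (E_lam x'E); rewrite eqL.
  rewrite (zE x'E) !expr1n => neq1 [] /esym/eqP; rewrite ?invr_eq1 ?(negbTE neq1) //.
have nii : self_inverse x != self_inverse x'.
  apply: contra_eqN eqL => /eqP ii; exact: lengths.
have opposite y y' i j : y \notin E -> y' \notin E -> self_inverse y -> ~~ self_inverse y' ->
    cycle_length y = cycle_length y' ->
    ~ pm (z y ^+ e ^+ (q ^ i)) (z y' ^+ e ^+ (q ^ j)).
  move=> yE y'E iy iy' eqLy.
  set U := _ ^+ (q ^ i); set V := _ ^+ (q ^ j) => UV.
  have UL : U ^+ (q ^ cycle_length y) = U^-1.
    by rewrite /U exprAC [z y ^+ e ^+ _]exprAC seed_period iy !exprVn.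
  have VL : V ^+ (q ^ cycle_length y) = V.
    by rewrite /V exprAC [z y' ^+ e ^+ _]exprAC eqLy seed_period (negbTE iy').
  have nzV : V != 0 by rewrite !expf_neq0 ?seed_neq0.
  have VV : V = V^-1.
    by case: UV => VU; rewrite -{1}VL VU ?exprVn UL // invrK.
  have V2 : V ^+ 2 = 1 by rewrite expr2 {1}VV mulVf.
  have U2 : U ^+ 2 = 1.
    by case: (UV) V2 => -> //; rewrite exprVn => /eqP; rewrite invr_eq1 => /eqP.
  have dvdy : (seed_order y %| e * 2)%N.
    rewrite (prim_order_dvd (z_prim yE)) exprM; apply/eqP/(@expq1 _ i).
    by rewrite [_ ^+ 2 ^+ _]exprAC U2.
  have dvdy' : (seed_order y' %| e * 2)%N.
    rewrite (prim_order_dvd (z_prim y'E)) exprM; apply/eqP/(@expq1 _ j).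
    by rewrite [_ ^+ 2 ^+ _]exprAC V2.
  move: (dvdy) dvdy'; rewrite /seed_order iy (negbTE iy') -eqLy.
  have : (q ^ 1 <= q ^ cycle_length y)%N by rewrite leq_exp2l // cycle_length_gt0.
  rewrite expn1 => qL d1 d2.
  have [e2 qL3] : e = 2%N /\ (q ^ cycle_length y = 3)%N.
    have := dvdn_leq _ d1; case: e12 => e_; rewrite e_ /= in d1 *.
      by move/(_ isT); lia.
    move/(_ isT) => le; split=> //; have : (q ^ cycle_length y = 2 \/ q ^ cycle_length y = 3)%N by lia.
    by case=> // qL2; rewrite qL2 in d1.
  have V1 : V = 1.
    have /prim_expr_order := z_prim y'E; rewrite /seed_order (negbTE iy') -eqLy qL3 /V e2 => ->.
    by rewrite expr1n.
  have := one _ yE iy; suff /expq1-> : z y ^+ e ^+ (q ^ i) = 1 by rewrite eqxx.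
  by rewrite -/U; case: UV => [<- // | E1]; rewrite -[U]invrK -E1 V1 invr1.
have [ix|ix] := boolP (self_inverse x).
  have ix' : ~~ self_inverse x' by move: nii; rewrite ix eq_sym eqb_id.
  exact: (@opposite x x' 0%N k).
have ix' : self_inverse x' by move: nii; rewrite (negbTE ix) /=; case: self_inverse.
by move=> /pm_sym; apply: (@opposite x' x k 0%N).
Qed.

End Seeds.

(** The last clause serves the types [B] and [C], where in addition no entry may
    be a square root of 1. *)
Lemma entries_from_seeds (E : {set 'I_n * bool}) :
    (forall x, x \in E -> self_inverse x && (cycle_length x == 1%N)) ->
    (forall x x', x \in E -> x' \in E -> x' \in entry_class w x) ->
    (forall x x', x \in E -> cycle_length x' = 1%N -> self_inverse x') ->
    (forall x x', x \notin E -> x' \notin E -> x' \notin entry_class w x ->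
       self_inverse x = self_inverse x' -> cycle_length x != cycle_length x') ->
  exists s : 'I_n -> K, [/\ forall i, s i != 0,
    forall p, entry s (w p) = entry s p ^+ q,
    forall i j, i != j -> s i ^+ e != s j ^+ e /\ s i ^+ e * s j ^+ e != 1
  & E = set0 -> (forall l, l \in lam -> (3 < q ^ l)%N) -> forall i, s i ^+ 2 != 1].
Proof.
move=> E_short E_single E_lam lengths.
have seeds x : exists zx : K, if x \in E then zx = 1 else (seed_order x).-primitive_root zx.
  have [xE|xE] := boolP (x \in E); first by exists 1.
  exact: (closed_primitive_root (seed_order_gt0 x) (seed_order_neq0 x)).
have [z zP] := fin_all_exists seeds.
have zE x : x \in E -> z x = 1 by move=> xE; have := zP x; rewrite xE.
have z_prim x : x \notin E -> (seed_order x).-primitive_root (z x).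
  by move=> xE; have := zP x; rewrite (negbTE xE).
have [s0 s0P] := propagate ws (seed_neq0 zE z_prim) (seed_period zE z_prim).
have s0z p : exists2 k, (iter k w (class_repr w p)).1 = p.1
    & pm (s0 p) (z (class_repr w p) ^+ (q ^ k)).
  have [_ _ [k [[kp sk]|[kp sk]]]] := s0P p; exists k; rewrite ?kp // sk.
    exact: pm_refl.
  by right; rewrite invrK.
pose s i := s0 (i, false).
have entryE p : entry s p = s0 p.
  by case: p => i [] //; have [_ + _] := s0P (i, false); rewrite /entry /= => <-.
have nzs i : s i != 0.
  have [k _] := s0z (i, false); have := seed_neq0 zE z_prim (class_repr w (i, false)).
  rewrite -/(s i) => nz [] E1; first by rewrite -E1 expf_neq0.
  by rewrite -[s i]invrK -E1 invr_eq0 expf_neq0.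
have sep i j : pm (s i ^+ e) (s j ^+ e) -> i = j.
  apply: (@entries_separated _ _ frob_inj _ _ ws (fun x => z x ^+ e) (fun p => s0 p ^+ e)
    _ _ _ _ (i, false) (j, false)).
  - move=> p; have [k kp sk] := s0z p; exists k => //.
    by rewrite exprAC; apply: pmX.
  - by move=> x; rewrite exprAC; apply: pmX; apply: (seed_pm_period zE z_prim).
  - by move=> x k; apply: (seed_minimal E_short).
  by move=> x x' k; apply: (seed_distinct E_short E_single E_lam lengths zE z_prim).
exists s; split=> // [p|i j ij|E0 lam3 i].
- by rewrite !entryE; have [] := s0P p.
- have nsep : ~ pm (s i ^+ e) (s j ^+ e) by move/sep/eqP; rewrite (negbTE ij).
  split; apply/eqP=> H; apply: nsep; first by left.
  by right; apply: (mulfI (expf_neq0 e (nzs i))); rewrite H mulfV // expf_neq0.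
have [k _ sk] := s0z (i, false); set x := class_repr w (i, false) in sk.
have xE : x \notin E by rewrite E0 inE.
apply/eqP=> s2.
have : z x ^+ 2 = 1.
  apply: (expq_inj frob_inj (k := k)); rewrite /= expr1n exprAC.
  by case: sk => ->; rewrite ?exprVn s2 ?invr1.
move/eqP; rewrite -(prim_order_dvd (z_prim x xE)) => /dvdn_leq -/(_ (ltn0Sn 1)); apply/negP.
rewrite -ltnNge /seed_order; have [ix|ix] := boolP (self_inverse x).
  by have : (q ^ 1 <= q ^ cycle_length x)%N; [rewrite leq_exp2l // cycle_length_gt0 | rewrite expn1; lia].
by have := lam3 _ (not_self_inverse_length ix); lia.
Qed.

Hypothesis lam_uniq : uniq lam.

Lemma torus_entries_distinct : uniq mu ->
  exists s : 'I_n -> K, [/\ forall i, s i != 0,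
    forall p, entry s (w p) = entry s p ^+ q,
    forall i j, i != j -> s i ^+ e != s j ^+ e /\ s i ^+ e * s j ^+ e != 1
  & (forall l, l \in lam -> (3 < q ^ l)%N) -> forall i, s i ^+ 2 != 1].
Proof.
move=> mu_uniq; have [|||x x' _ _ nx ii|s [nzs sw sep s2]] := @entries_from_seeds set0.
- by move=> x; rewrite inE.
- by move=> x x'; rewrite inE.
- by move=> x x'; rewrite inE.
- have [ix|ix] := boolP (self_inverse x); last first.
    by apply: distinct_lengths_minus => //; rewrite -ii.
  apply/eqP=> eqL; have := distinct_lengths_plus nx ix _ eqL; rewrite -ii => /(_ ix).
  by rewrite count_uniq_mem //; case: (_ \in _).
by exists s; split=> //; apply: s2.
Qed.

(** One of the two self-inverse cycles with [m = 1] receives the value 1; as the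
    parts of [lam] exceed 2, no other class has length 1. *)
Lemma torus_entries_pair mu' : all (fun l => 2 < l)%N lam ->
    mu = [:: 1%N, 1%N & mu'] -> uniq (1%N :: mu') ->
  exists s : 'I_n -> K, [/\ forall i, s i != 0,
    forall p, entry s (w p) = entry s p ^+ q
  & forall i j, i != j -> s i ^+ e != s j ^+ e /\ s i ^+ e * s j ^+ e != 1].
Proof.
move=> lam3 muE mu'_uniq; have /andP[mu'1 _] := mu'_uniq.
have [x0 ix0 Lx0] : exists2 x, self_inverse x & cycle_length x = 1%N.
  have : (2 * 1)%N \in [seq (2 * m)%N | m <- mu] by rewrite map_f // muE inE eqxx.
  case: wt => /perm_mem <- _ /mapP[P]; rewrite mem_filter mem_enum => /andP[iP].
  case/imsetP=> x _ eP; rewrite eP self_inverse_cycleE // in iP * => c2.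
  exists x => //; have [c _] := iter_half ws iP.
  by apply/eqP; rewrite -(eqn_pmul2l (ltn0Sn 1)) -c -c2.
have Ex x : x \in porbit w x0 -> self_inverse x && (cycle_length x == 1%N).
  move=> xx0; have eqP := porbit_eq xx0.
  have ix : self_inverse x.
    by rewrite -self_inverse_cycleE // eqP self_inverse_cycleE.
  by rewrite ix -Lx0 /cycle_length ix ix0 eqP eqxx.
have [|||s [nzs sw sep _]] := @entries_from_seeds (porbit w x0) Ex.
- move=> x x' xx0 x'x0; rewrite in_class //; apply/orP; left.
  by rewrite (porbit_eq xx0).
- move=> x x' _ L1; apply/negPn/negP=> /not_self_inverse_length.
  by rewrite L1 => /(allP lam3).
- move=> x x' xx0 x'x0 nx ii; have [ix|ix] := boolP (self_inverse x); last first.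
    by apply: distinct_lengths_minus => //; rewrite -ii.
  apply/eqP=> eqL; have ix' : self_inverse x' by rewrite -ii.
  have [L1|Ln1] := eqVneq (cycle_length x) 1%N; last first.
    have := distinct_lengths_plus nx ix ix' eqL; rewrite muE /= !(eq_sym 1%N) (negbTE Ln1) !add0n.
    by rewrite count_uniq_mem; [case: (_ \in _) | case/andP: mu'_uniq].
  have : (3 <= count_mem 1%N mu)%N.
    apply: (@count_self_inverse _ [:: x0; x; x']) => /=.
      rewrite !inE negb_or (porbit_neq nx) !andbT eq_sym !eq_porbit_mem.
      by rewrite xx0 porbit_sym x'x0.
    by rewrite ix0 ix ix' Lx0 -eqL L1.
  by rewrite muE /= (count_memPn mu'1).
by exists s.
Qed.

End TorusEntries.
End CycleType.

(** * Frobenius maps *)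

Section Frobenius.
Variables (Fq : finFieldType) (K : closedFieldType) (iota : {rmorphism Fq -> K}).
Local Notation q := #|Fq|.

Lemma card_pchar : [pchar K].-nat q.
Proof.
have [p p_pr pF] := finPcharP Fq.
have -> : q = (p ^ logn p q)%N by apply: (card_pprimeChar pF).
rewrite pnatX; apply/orP; left; rewrite pnatE //.
by rewrite (fmorph_pchar iota).
Qed.

Lemma card_eq0 : q%:R = 0 :> K.
Proof.
have [p p_pr pF] := finPcharP Fq.
have cq : q = (p ^ logn p q)%N by apply: (card_pprimeChar pF).
have pK : p \in [pchar K] by rewrite (fmorph_pchar iota).
rewrite cq natrX (pcharf0 pK) expr0n; case: eqP => // k0.
by have := finNzRing_gt1 Fq; rewrite cq k0.
Qed.

Lemma frobD (x y : K) : (x + y) ^+ q = x ^+ q + y ^+ q.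
Proof. exact: exprDn_pchar card_pchar. Qed.

Lemma frob_inj : injective (fun x : K => x ^+ q).
Proof.
move=> x y /= xy; have : (x - y) ^+ q = 0.
  by apply: (addIr (y ^+ q)); rewrite -frobD subrK add0r.
by move/eqP; rewrite expf_eq0 subr_eq0 => /andP[_ /eqP].
Qed.

Lemma frob_mulmx m p r (x : 'M[K]_(m, p)) (y : 'M[K]_(p, r)) :
  map_mx (fun c => c ^+ q) (x *m y) =
  map_mx (fun c => c ^+ q) x *m map_mx (fun c => c ^+ q) y.
Proof.
apply/matrixP=> i j; rewrite !mxE.
have frob0 : (0 : K) ^+ q = 0 by rewrite expr0n -leqn0 leqNgt (ltnW (finNzRing_gt1 Fq)).
rewrite (big_morph (fun c => c ^+ q) frobD frob0).
by apply: eq_bigr => k _; rewrite !mxE exprMn.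
Qed.

Lemma qform_swap n : (0 < n)%N -> qform (swap_vector K n 0) = 1.
Proof.
move=> n0; rewrite /qform big_ord0 addr0.
have lt_n1 : (n.-1 < n)%N by rewrite ltn_predL.
rewrite (bigD1 (Ordinal lt_n1)) //= big1 => [|i].
  rewrite !mxE /= eqxx /= addr0 (_ : (n + n.-1 == (n + n).-1)%N) ?orbT ?mulr1 //.
  by apply/eqP; lia.
rewrite -val_eqE /= => /negbTE ni; rewrite !mxE /= ni /=.
have -> : (i == (n + n).-1 :> nat) = false by have := ltn_ord i; case: eqP => //; lia.
by rewrite mul0r.
Qed.

Lemma frobeniusM X n (x y : 'M[K]_(ambient_dim X n)) : (0 < n)%N ->
  frobenius q (x *m y) = frobenius q x *m frobenius q y.
Proof.
move=> n0; case: X x y => [||[]] x y; rewrite /frobenius ?frob_mulmx //.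
set u := clifford _; have uu : u *m u = 1%:M.
  by rewrite /u clifford_sqr qform_swap.
have uU : u \in unitmx by case: (mulmx1_unit uu).
by rewrite !mulmxA; congr (_ *m _); rewrite -!mulmxA mulKmx.
Qed.

End Frobenius.

(** * Symplectic groups *)

Section Symplectic.
Variables (K : fieldType) (n : nat).
Implicit Types (x y : 'M[K]_(n + n)) (a : 'I_n -> K).

Definition sp_diag a : 'M[K]_(n + n) := diag_mx (row_mx (\row_i a i) (\row_i (a i)^-1)).

Local Notation J := (block_mx 0 1%:M (- 1%:M) 0 : 'M[K]_(n + n)).

Lemma symplectic_formK : - J *m J = 1%:M.
Proof.
rewrite mulNmx mulmx_block.
rewrite !(mul0mx, mulmx0, add0r, addr0, mulmx1, mul1mx, mulmxN, mulNmx).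
by rewrite opp_block_mx !opprK !oppr0 -scalar_mx_block.
Qed.

Lemma symplectic_unit x : symplectic x -> x \in unitmx.
Proof.
move=> sx; have : (- J *m x^T *m J) *m x = 1%:M.
  by rewrite -!mulmxA (mulmxA x^T) sx symplectic_formK.
by case/mulmx1_unit.
Qed.

Lemma symplecticM x y : symplectic x -> symplectic y -> symplectic (x *m y).
Proof.
move=> sx sy; rewrite /symplectic trmx_mul.
by rewrite -!mulmxA (mulmxA J) (mulmxA x^T) (mulmxA x^T) sx mulmxA sy.
Qed.

Lemma symplecticV x : symplectic x -> symplectic (invmx x).
Proof.
move=> sx; have ux := symplectic_unit sx; rewrite /symplectic.
rewrite -{1}sx trmx_inv !mulmxA mulVmx ?unitmx_tr // mul1mx -mulmxA mulmxV // mulmx1 //.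
Qed.

Lemma diag_symplectic (u v : 'rV[K]_n) :
  symplectic (diag_mx (row_mx u v)) <-> forall i, u 0 i * v 0 i = 1.
Proof.
rewrite /symplectic tr_diag_mx diag_mx_row !mulmx_block.
rewrite !(mul0mx, mulmx0, add0r, addr0, mulmx1, mulmxN, mulNmx).
rewrite !mulmx_diag; split=> [/eq_block_mx[_ /matrixP E _ _] i | E].
  by have := E i i; rewrite !mxE eqxx.
have E1 : \row_j (u 0 j * v 0 j) = const_mx 1 by apply/rowP=> i; rewrite !mxE.
have E2 : \row_j (v 0 j * u 0 j) = const_mx 1 by apply/rowP=> i; rewrite !mxE mulrC.
by rewrite E1 E2 diag_const_mx.
Qed.

Lemma sp_diag_symplectic a : (forall i, a i != 0) -> symplectic (sp_diag a).
Proof. by move=> nza; apply/diag_symplectic => i; rewrite !mxE mulfV. Qed.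

(** The entries of a regular element are distinct, so its centraliser consists
    of diagonal matrices. *)
Lemma sp_centraliser s x : (forall i, s i != 0) ->
    (forall i j, i != j -> s i != s j /\ s i * s j != 1) ->
    (forall i, s i ^+ 2 != 1) -> symplectic x ->
    x *m sp_diag s = sp_diag s *m x ->
  exists2 a, forall i, a i != 0 & x = sp_diag a.
Proof.
move=> nzs sep s2 sx comm.
pose d := row_mx (\row_i s i) (\row_i (s i)^-1).
have dl i : d 0 (lshift n i) = s i by rewrite row_mxEl mxE.
have dr i : d 0 (rshift n i) = (s i)^-1 by rewrite row_mxEr mxE.
have neq_inv i j : s i != (s j)^-1.
  have [->|ij] := eqVneq i j.
    by apply: contraNneq (s2 j) => sj; rewrite expr2 {1}sj mulVf.
  have [_] := sep i j ij; apply: contraNneq => ->.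
  by rewrite mulVf.
have d_inj i j : i != j -> d 0 i != d 0 j.
  case: (split_ordP i) (split_ordP j) => i' -> [] j' ->; rewrite ?dl ?dr.
  - by rewrite (inj_eq (@lshift_inj _ _)) => /sep[].
  - by rewrite neq_inv.
  - by move=> _; rewrite eq_sym neq_inv.
  by rewrite (inj_eq (@rshift_inj _ _)) (inj_eq invr_inj) => /sep[].
have {}comm : x *m diag_mx d = diag_mx d *m x by [].
clearbody d; have x0 i j : i != j -> x i j = 0.
  move=> ij; have /matrixP/(_ i j) := comm.
  rewrite mul_mx_diag mul_diag_mx !mxE mulrC => /eqP.
  rewrite -subr_eq0 -mulrBl mulf_eq0 subr_eq0 (negbTE (d_inj j i _)) 1?eq_sym //=.
  by move/eqP.
pose u := \row_i x (lshift n i) (lshift n i); pose v := \row_i x (rshift n i) (rshift n i).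
have xE : x = diag_mx (row_mx u v).
  apply/matrixP=> i j; rewrite mxE; have [<-|ij] := eqVneq i j; last by rewrite x0.
  by case: (split_ordP i) => i' ->; rewrite ?row_mxEl ?row_mxEr mxE.
rewrite xE in sx; have uv := (diag_symplectic u v).1 sx.
have nzu i : u 0 i != 0 by apply: contra_eq_neq (uv i) => ->; rewrite mul0r eq_sym oner_eq0.
exists (fun i => u 0 i) => //; rewrite xE /sp_diag; congr (diag_mx (row_mx _ _)).
  by apply/rowP=> i; rewrite [RHS]mxE.
by apply/rowP=> i; rewrite [RHS]mxE -[LHS](mulKf (nzu i)) uv mulr1.
Qed.

End Symplectic.

(** * Regular elements of maximal tori *)

Section Main.
Variables (Fq : finFieldType) (K : closedFieldType) (iota : {rmorphism Fq -> K}).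
Variables (X : classical_type) (n : nat).
Hypothesis n0 : (0 < n)%N.
Local Notation q := #|Fq|.
Local Notation G := (@classical_group K X n).

Lemma classical_group_unit x : G x -> x \in unitmx.
Proof. by case: X x => [||tw] x; [apply: spin_unit|apply: symplectic_unit|apply: spin_unit]. Qed.

Lemma classical_groupM x y : G x -> G y -> G (x *m y).
Proof. by case: X x y => [||tw] x y; [apply: spinM|apply: symplecticM|apply: spinM]. Qed.

Lemma classical_groupV x : G x -> G (invmx x).
Proof. by case: X x => [||tw] x; [apply: spinV|apply: symplecticV|apply: spinV]. Qed.

Definition torus_param : ('I_n -> K) -> 'M[K]_(ambient_dim X n) :=
  match X as Y return ('I_n -> K) -> 'M[K]_(ambient_dim Y n) with
  | TypeB => fun c => torus_elt (extend (b := 1) c)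
  | TypeC => fun c => sp_diag c
  | TypeD _ => fun c => torus_elt (extend (b := 0) c)
  end.

Lemma torus_param_group c : (forall i, c i != 0) -> G (torus_param c).
Proof.
rewrite /torus_param; case: X => [||tw] nzc /=; first exact: torus_spin.
  exact: sp_diag_symplectic.
exact: torus_spin.
Qed.

Lemma eq_torus_param c c' : c =1 c' -> torus_param c = torus_param c'.
Proof.
have extE b (cc' : c =1 c') : extend (b := b) c =1 extend (b := b) c'.
  by move=> i; rewrite /extend; case: split => // j.
rewrite /torus_param; case: X => [||tw] cc'; try by apply: eq_torus_elt; apply: extE.
rewrite /sp_diag; congr (diag_mx (row_mx _ _)); apply/rowP=> i;
by rewrite !mxE cc'.
Qed.

Lemma torus_param1 : torus_param (fun=> 1) = 1%:M.
Proof.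
have ext1 b : torus_elt (extend (b := b) (fun _ : 'I_n => 1 : K)) = 1%:M.
  by rewrite -torus_elt1; apply: eq_torus_elt => i; rewrite /extend; case: split.
rewrite /torus_param; case: X => [||tw]; [exact: ext1 | | exact: ext1].
apply/matrixP=> i j; rewrite [LHS]mxE [RHS]mxE; congr (_ *+ _).
by case: (split_ordP i) => k ->; rewrite ?row_mxEl ?row_mxEr mxE ?invr1.
Qed.

Lemma torus_param_regular (Q : {poly K}) (c : K -> 'I_n -> K) :
    (forall i, regular_off Q (c^~ i)) ->
    (forall i, regular_off Q (fun z => (c z i)^-1)) ->
  regular_mx_off Q (fun z => torus_param (c z)).
Proof.
move=> regc regV.
have regT b : regular_mx_off Q (fun z => torus_elt (extend (b := b) (c z))).
  move=> i j.
  have [ij|neq] := eqVneq i j; last first.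
    apply: eq_regular_off (regular_off_cst Q 0) => z _.
    by rewrite mxE (inj_eq enum_val_inj) (negbTE neq).
  apply: (@eq_regular_off _ _ (fun z => weight (extend (c z)) (enum_val j))) => [z _|].
    by rewrite mxE ij eqxx.
  apply: regular_off_prod => k; case: (split_ordP k) => l ->.
    case: (lshift b l \in _); [apply: eq_regular_off (regc l) | apply: eq_regular_off (regV l)];
    by move=> z _; rewrite extendl.
  by apply: eq_regular_off (regular_off_cst Q 1) => z _; rewrite extendr invr1 if_same.
rewrite /torus_param; case: X => [||tw]; [exact: regT | move=> i j | exact: regT].
have [ij|neq] := eqVneq i j; last first.
  by apply: eq_regular_off (regular_off_cst Q 0) => z _; rewrite mxE (negbTE neq).
rewrite -{}ij; case: (split_ordP i) => l ->.
  by apply: eq_regular_off (regc l) => z _; rewrite mxE eqxx row_mxEl mxE.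
by apply: eq_regular_off (regV l) => z _; rewrite mxE eqxx row_mxEr mxE.
Qed.

Lemma torus_param_comm c c' : torus_param c *m torus_param c' = torus_param c' *m torus_param c.
Proof.
have com b : torus_elt (extend (b := b) c) *m torus_elt (extend (b := b) c') =
    torus_elt (extend (b := b) c') *m torus_elt (extend (b := b) c).
  by rewrite !torus_eltM; apply: eq_torus_elt => i; apply: mulrC.
rewrite /torus_param; case: X => [||tw] //=.
by rewrite /sp_diag !mulmx_diag; congr diag_mx; apply/rowP=> i; rewrite !mxE mulrC.
Qed.

Lemma diagonal_torus_param x a : diagonal_torus x a ->
  exists2 c, forall i, c i != 0 & x = torus_param c.
Proof.
rewrite /torus_param; case: X x => [||tw] x [Gx nza xa].
- by have [c [nzc _ ->]] := torus_lift (leqnn 1) n0 Gx nza xa; exists c.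
- by exists a.
by have [c [nzc _ ->]] := torus_lift (leq0n 1) n0 Gx nza xa; exists c.
Qed.

(** By conjugation with [g] it is enough to find [t] in the diagonal torus; the
    centraliser of [t] being contained in that torus makes it regular. *)

Section Transfer.
Variables (T : 'M[K]_(ambient_dim X n) -> Prop) (g t : 'M[K]_(ambient_dim X n)).
Hypothesis Gg : G g.
Hypothesis TE : forall x, T x <-> exists a, diagonal_torus (invmx g *m x *m g) a.
Hypothesis tT : exists a, diagonal_torus t a.
Hypothesis centr_t : forall x, G x -> x *m t = t *m x -> exists a, diagonal_torus x a.
Hypothesis Ft : invmx g *m frobenius q (g *m t *m invmx g) *m g = t.

Lemma regular_transfer : exists t, [/\ T t, frobenius q t = t & regular_in T t].
Proof.
have ug := classical_group_unit Gg.
have conjK x : invmx g *m (g *m x *m invmx g) *m g = x.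
  by rewrite !mulmxA mulVmx // mul1mx mulmxKV.
have conjVK x : g *m (invmx g *m x *m g) *m invmx g = x.
  by rewrite !mulmxA mulmxV // mul1mx mulmxK.
exists (g *m t *m invmx g); split.
- by apply/TE; rewrite conjK.
- by rewrite -[LHS]conjVK Ft.
move=> x; split=> [[C [_ CS _ /CS[Gx comm]]] | /TE[a xa]].
  apply/TE/centr_t.
    by apply: classical_groupM => //; apply: classical_groupM => //; apply: classical_groupV.
  have /= := congr1 (fun y => invmx g *m y *m g) comm.
  by rewrite !mulmxA mulmxKV // mulVmx // mul1mx.
have [b tb] := tT.
have [c' nzc' tE] := diagonal_torus_param tb.
have [c nzc xE] := diagonal_torus_param xa.
rewrite -[x]conjVK xE; move: c nzc {xE xa}.
apply: (torus_identity_component (tau := fun c => g *m torus_param c *m invmx g)).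
- by move=> c d /eq_torus_param->.
- move=> c nzc; split; last first.
    rewrite tE !mulmxA !(mulmxKV ug) -!(mulmxA g).
    by rewrite torus_param_comm.
  apply: classical_groupM; last exact: classical_groupV.
  by apply: classical_groupM => //; apply: torus_param_group.
- by rewrite torus_param1 mulmx1 mulmxV.
move=> Q c regc regV.
apply: regular_mx_offM; last exact: regular_mx_off_cst.
apply: regular_mx_offM; first exact: regular_mx_off_cst.
exact: torus_param_regular.
Qed.

End Transfer.
End Main.

Section Fixed.
Variables (K : closedFieldType) (q n : nat).

Lemma entries_unique (a' : 'I_n -> K) (w : {perm 'I_n * bool}) s :
  (forall p, entry s (w p) = entry s p ^+ q) ->
  (forall p, entry a' (w p) = entry s p ^+ q) -> a' =1 s.
Proof.
move=> sw aw i; have := aw (w^-1 (i, false))%g; rewrite -sw permKV.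
by [].
Qed.

(** [Phi] stands for the Frobenius map conjugated by [g].  With [x] over the
    diagonal matrix with entries [s], both [x] and [Phi x] lie over the same
    matrix, so they have the same square [torus_elt (extend s)]. *)
Lemma spin_fixed b (Phi : 'M[K]_(spin_dim (n + b)) -> 'M[K]_(spin_dim (n + b)))
    (w : {perm 'I_n * bool}) (s : 'I_n -> K) :
    (b <= 1)%N -> (0 < n)%N ->
    (forall x y, Phi (x *m y) = Phi x *m Phi y) ->
    (forall x a, [/\ spin x, forall i, a i != 0 & spin_covers x (diag_entries b a)] ->
      exists2 a', [/\ spin (Phi x), forall i, a' i != 0 & spin_covers (Phi x) (diag_entries b a')]
        & forall p, entry a' (w p) = entry a p ^+ q) ->
    (forall i, s i != 0) -> (forall p, entry s (w p) = entry s p ^+ q) ->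
  Phi (torus_elt (extend s)) = torus_elt (extend s).
Proof.
move=> b1 n0 PhiM Phi_torus nzs sw.
have [c cs] := fin_all_exists (fun i => closed_sqrt (s i)).
have nzc i : c i != 0 by have := nzs i; rewrite -cs expf_eq0.
have cov := @torus_covers K n b c s nzc cs.
have sc := @torus_spin K n b c nzc.
have -> : torus_elt (extend (b := b) s) = torus_elt (extend c) *m torus_elt (extend c).
  by rewrite (torus_lift_sqr b1 n0 sc nzs cov).
rewrite PhiM (torus_lift_sqr b1 n0 sc nzs cov).
have [a' [sa nza cova] aw] := Phi_torus _ _ (And3 sc nzs cov).
rewrite (torus_lift_sqr b1 n0 sa nza cova); apply: eq_torus_elt => i.
have E := entries_unique sw aw.
by rewrite /extend; case: split => // j.
Qed.

Lemma extend_separated b (s : 'I_n -> K) : (b <= 1)%N ->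
    (forall i j, i != j -> s i ^+ 2 != s j ^+ 2 /\ s i ^+ 2 * s j ^+ 2 != 1) ->
    ((0 < b)%N -> forall i, s i ^+ 2 != 1) ->
  forall i j : 'I_(n + b), i != j ->
    extend s i ^+ 2 != extend s j ^+ 2 /\ extend s i ^+ 2 * extend s j ^+ 2 != 1.
Proof.
move=> b1 sep s2 i j; case: (split_ordP i) (split_ordP j) => k -> [] l -> kl.
- by rewrite !extendl; apply: sep; apply: contraNneq kl => ->.
- by rewrite extendl extendr expr1n mulr1; split; apply: s2; exact: leq_ltn_trans (ltn_ord l).
- rewrite extendl extendr expr1n mul1r eq_sym.
  by split; apply: s2; exact: leq_ltn_trans (ltn_ord k).
by rewrite (ord_b_unique b1 k l) eqxx in kl.
Qed.

End Fixed.

Theorem lemma2p1 (Fq : finFieldType) (K : closedFieldType)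
    (iota : {rmorphism Fq -> K}) (Kalg : forall x : K, algebraicOver iota x)
    (X : classical_type) (n : nat) (hn : simple_rank X n)
    (lam mu : seq nat) (hpart : partition_pair n lam mu)
    (T : 'M[K]_(ambient_dim X n) -> Prop)
    (hT : corresponds #|Fq| T lam mu) :
    [\/ [/\ (3 < #|Fq|)%N, sorted ltn lam & sorted ltn mu],
        [/\ #|Fq| = 2%N \/ #|Fq| = 3%N, sorted ltn lam, sorted ltn mu,
            2%N \notin lam & X = TypeB \/ X = TypeC -> 1%N \notin lam]
      | [/\ exists tw, X = TypeD tw, sorted ltn lam,
            all (fun l => 2 < l)%N lam
          & exists2 mu', mu = [:: 1%N, 1%N & mu'] & sorted ltn (1%N :: mu')]] ->
  exists t, [/\ T t, frobenius #|Fq| t = t & regular_in T t].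
Proof.
move=> conds; have [g [w [Gg TE ws tw wt]]] := hT.
have n0 : (0 < n)%N by case: (X) hn => [||?] //; apply: leq_trans.
have ug := classical_group_unit Gg.
set q := #|Fq| in conds tw *.
have q1 : (1 < q)%N := finNzRing_gt1 Fq.
have lam_uniq : uniq lam.
  by apply: (sorted_uniq ltn_trans ltnn); case: conds => [[]|[]|[]].
have lam2 l : l \in lam -> (q <= 3)%N -> l <> 2%N.
  move=> ll q3 l2; case: conds => [[q4 _ _]|[_ _ _ n2 _]|[_ _ /allP lam3 _]].
  - by rewrite ltnNge q3 in q4.
  - by rewrite -l2 ll in n2.
  by have := lam3 _ ll; rewrite l2.
have mu_uniq : ~ (exists d, X = TypeD d) -> uniq mu.
  move=> nD; apply: (sorted_uniq ltn_trans ltnn).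
  by case: conds => [[]|[]|[]].
have lam3 : ~ (exists d, X = TypeD d) -> forall l, l \in lam -> (3 < q ^ l)%N.
  move=> nD l ll; have l0 : (0 < l)%N.
    by rewrite lt0n; case: hpart => _ _ + _ _; apply: contraNneq => <-.
  case: conds => [[q4 _ _]|[q23 _ _ n2 n1]|[//]].
    by apply: leq_trans q4 _; rewrite -{1}[q]expn1 leq_exp2l.
  have l3 : (2 < l)%N.
    have : l != 1%N.
      by apply: contraNneq (n1 _) => [<- //|]; case: (X) nD => [||d] nD; [left|right|case: nD; exists d].
    have : l != 2%N by apply: contraNneq n2 => <-.
    by case: l l0 {ll} => [|[|[|l]]].
  have : (2 ^ 3 <= q ^ l)%N.
    by apply: leq_trans (_ : 2 ^ l <= _)%N; [rewrite leq_exp2l | rewrite leq_exp2r].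
  exact: leq_trans.
have frob := @frob_inj _ _ iota; have qK := card_eq0 iota.
have PhiM (x y : 'M[K]_(ambient_dim X n)) :
    invmx g *m frobenius q (g *m (x *m y) *m invmx g) *m g =
    (invmx g *m frobenius q (g *m x *m invmx g) *m g) *m
    (invmx g *m frobenius q (g *m y *m invmx g) *m g).
  have -> : g *m (x *m y) *m invmx g = (g *m x *m invmx g) *m (g *m y *m invmx g).
    by rewrite !mulmxA mulmxKV.
  by rewrite (frobeniusM iota) // !mulmxA mulmxK.
case: X hn T hT conds g Gg TE tw ug mu_uniq lam3 PhiM => [||d] hn T hT conds g Gg TE tw ug mu_uniq lam3 PhiM.
- have nD : ~ (exists d, TypeB = TypeD d) by case.
  have [s [nzs sw sep s2]] := torus_entries_distinct ws wt q1 qK (or_intror erefl) frob lam2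
    lam_uniq (mu_uniq nD).
  apply: (@regular_transfer _ _ _ _ n0 T g (torus_elt (extend s)) Gg TE).
  + exists (fun i => s i ^+ 2); split; first exact: torus_spin.
      by move=> i; rewrite expf_neq0.
    exact: torus_covers.
  + move=> x sx comm; have [a nza cov] := centraliser_covers (leqnn 1) nzs sx comm
      (extend_separated (leqnn 1) sep (fun _ => s2 (lam3 nD))).
    by exists a.
  apply: (spin_fixed (Phi := fun x => invmx g *m frobenius q (g *m x *m invmx g) *m g) (w := w) _ n0 PhiM tw) => //.
- have nD : ~ (exists d, TypeC = TypeD d) by case.
  have [s [nzs sw sep s2]] := torus_entries_distinct ws wt q1 qK (or_introl erefl) frob lam2
    lam_uniq (mu_uniq nD).
  have tor : diagonal_torus (X := TypeC) (sp_diag s) s.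
    by split=> //; apply: sp_diag_symplectic.
  apply: (@regular_transfer _ _ _ _ n0 T g (sp_diag s) Gg TE).
  + by exists s.
  + move=> x sx comm; have [a nza ->] := sp_centraliser nzs sep (s2 (lam3 nD)) sx comm.
    by exists a; split=> //; apply: sp_diag_symplectic.
  have [a [_ _ ->] aw] := tw _ _ tor; have E := entries_unique sw aw.
  by congr (diag_mx (row_mx _ _)); apply/rowP=> i; rewrite !mxE E.
have [s [nzs sw sep]] : exists s : 'I_n -> K, [/\ forall i, s i != 0,
    forall p, entry s (w p) = entry s p ^+ q
  & forall i j, i != j -> s i ^+ 2 != s j ^+ 2 /\ s i ^+ 2 * s j ^+ 2 != 1].
  have dist : sorted ltn mu -> _ := fun smu => torus_entries_distinct ws wt q1 qK
    (or_intror erefl) frob lam2 lam_uniq (sorted_uniq ltn_trans ltnn smu).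
  case: conds => [[_ _ /dist[s [nzs sw sep _]]]|[_ _ /dist[s [nzs sw sep _]] _ _]|].
  + by exists s.
  + by exists s.
  case=> _ _ lam3' [mu' muE smu'].
  exact: (torus_entries_pair ws wt q1 qK (or_intror erefl) frob lam2 lam_uniq lam3' muE
    (sorted_uniq ltn_trans ltnn smu')).
apply: (@regular_transfer _ _ _ _ n0 T g (torus_elt (extend s)) Gg TE).
+ exists (fun i => s i ^+ 2); split; first exact: torus_spin.
    by move=> i; rewrite expf_neq0.
  exact: torus_covers.
+ move=> x sx comm; have [a nza cov] := centraliser_covers (leq0n 1) nzs sx comm
    (@extend_separated K n 0 s (leq0n 1) sep (fun h => False_ind _ (notF h))).
  by exists a.
apply: (spin_fixed (Phi := fun x => invmx g *m frobenius q (g *m x *m invmx g) *m g) (w := w) _ n0 PhiM tw) => //.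
Qed.
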